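(* Let $\pi$ be an order-$q$-subplane of $\mathrm{PG}(2,q^3)$ exterior to $\ell_\infty$, and let $P$ be a point of $\pi$. Label the lines of $\pi$ through $P$ by $\ell_0,\ldots,\ell_q$. In $\mathrm{PG}(6,q)$, $\ell_i$ corresponds to a twisted cubic $[\ell_i]$. Let $m_i$ be the unique tangent line to $[\ell_i]$ through $P$ (the tangent at $P$). Then the lines $m_0,\ldots,m_q$ lie in a plane $\mathcal T_P$ of $\mathrm{PG}(6,q)$ (called the tangent plane of $[\pi]$ at $P$).
   Context: Let $q$ be a prime power and let $\tau$ be a primitive element of $\mathbb F_{q^3}$. For $\alpha=a_0+a_1\tau+a_2\tau^2\in\mathbb F_{q^3}$ with $a_i\in\mathbb F_q$, write $[\alpha]=(a_0,a_1,a_2)$. In $\mathrm{PG}(2,q^3)$, with homogeneous coordinates $(x,y,z)$, $\ell_\infty$ is the line $z=0$. In $\mathrm{PG}(6,q)$, with homogeneous coordinates $(x_0,x_1,x_2,y_0,y_1,y_2,z)$, $\Sigma_\infty\cong\mathrm{PG}(5,q)$ is the hyperplane $z=0$. The Bruck-Bose correspondence sends an affine point $(\alpha,\beta,1)$ of $\mathrm{PG}(2,q^3)$ to the affine point $([\alpha],[\beta],1)$ of $\mathrm{PG}(6,q)$ (also denoted by the same letter), and a point $L=(\alpha,\beta,0)$ of $\ell_\infty$ to the plane $[L]=\{([\alpha x],[\beta x],0): x\in\mathbb F_{q^3}\setminus\{0\}\}$ of $\Sigma_\infty$. The planes $[L]$ form a regular 2-spread $\mathcal S$ of $\Sigma_\infty$.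 For a set $X$ of points of $\mathrm{PG}(2,q^3)$, $[X]$ denotes the corresponding set in $\mathrm{PG}(6,q)$. In the cubic extension $\mathrm{PG}(6,q^3)$ there are exactly three lines meeting the extension of every plane of $\mathcal S$. They are skew, disjoint from $\mathrm{PG}(6,q)$, and conjugate under $X\mapsto X^q$; they are called the transversals of $\mathcal S$. An order-$q$-subplane of $\mathrm{PG}(2,q^3)$ is an image of $\mathrm{PG}(2,q)$ under $\mathrm{PGL}(3,q^3)$; it is exterior to $\ell_\infty$ if none of its points lies on $\ell_\infty$. Its lines are order-$q$-sublines, each consisting of $q+1$ points of $\pi$. An $\mathcal S$-special twisted cubic is a twisted cubic in a 3-space of $\mathrm{PG}(6,q)$, not contained in $\Sigma_\infty$, through a plane of $\mathcal S$, whose extension to $\mathrm{PG}(6,q^3)$ meets the three transversals of $\mathcal S$. It is a known result that each line $\ell_i$ of an exterior subplane $\pi$ (a subline disjoint from $\ell_\infty$) corresponds in $\mathrm{PG}(6,q)$ to an $\mathcal S$-special twisted cubic $[\ell_i]$, lying in a 3-space through the plane $[L_i]$, where $L_i$ is the point in which the extension of $\ell_i$ meets $\ell_\infty$. Tangent lines are taken with respect to this $\mathcal S$-special twisted cubic. *)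

(* Defs.v *)
From HB Require Import structures.
From mathcomp Require Import all_boot all_order all_algebra all_field.

Set Implicit Arguments.
Unset Strict Implicit.
Unset Printing Implicit Defensive.

Import GRing.Theory.
Local Open Scope ring_scope.

(* A subspace of PG(n, F) of projective dimension d is a vector subspace of
   F^(n+1) of dimension d + 1; in particular a point is a 1-dimensional vector
   subspace, and a set of points is a predicate on subspaces. *)
Definition subspace (F : fieldType) (n : nat) := {vspace 'rV[F]_n.+1}.

Definition point_set (F : fieldType) (n : nat) := subspace F n -> Prop.

(* The hyperplane on which the last homogeneous coordinate vanishes: it is
   l_oo in PG(2, q^3) and Sigma_oo in PG(6, q). *)
Definition hyperplane_inf (F : fieldType) (n : nat) : subspace F n :=
  (\sum_(i < n.+1 | i != ord_max) <[delta_mx ord0 i : 'rV[F]_n.+1]>)%VS.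

Section Subplanes.
Variables (K : finFieldType) (L : fieldExtType K).

Definition vec3 (a b c : L) : 'rV[L]_3 := \row_(i < 3) [:: a; b; c]`_i.

(* Image of PG(2, K) under the projectivity induced by an invertible A. *)
Definition is_subplane (pi : point_set L 2) : Prop :=
  exists2 A : 'M[L]_3, A \in unitmx &
    forall U, pi U <->
      exists2 v : 'rV[K]_3, v != 0 & U = <[map_mx (in_alg L) v *m A]>%VS.

Definition exterior (pi : point_set L 2) : Prop :=
  forall U, pi U -> ~~ (U <= hyperplane_inf L 2)%VS.

(* A line of a subplane is represented by its extension, i.e. by the line of
   PG(2, q^3) carrying it; [subline] recovers its set of points. *)
Definition is_subplane_line (pi : point_set L 2) (l : subspace L 2) : Prop :=
  \dim l = 2%N /\
  exists U V, [/\ pi U, pi V, U != V, (U <= l)%VS & (V <= l)%VS].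

Definition subline (pi : point_set L 2) (l : subspace L 2) : point_set L 2 :=
  fun U => pi U /\ (U <= l)%VS.

End Subplanes.

Section BruckBose.
Variables (K : finFieldType) (L : fieldExtType K) (tau : L).

(* [coords alpha] is (a_0, a_1, a_2) where
   alpha = a_0 + a_1 tau + a_2 tau ^ 2; meaningful when 1, tau, tau ^ 2 is a
   basis of L over K. *)
Definition coords (alpha : L) : 'rV[K]_3 :=
  \row_(i < 3) coord [tuple 1; tau; tau ^+ 2] i alpha.

Definition bb_vec (alpha beta : L) (z : K) : 'rV[K]_7 :=
  row_mx (row_mx (coords alpha) (coords beta)) (z%:M : 'rV[K]_1).

(* The plane [(alpha, beta, 0)] of the spread. *)
Definition spread_plane (alpha beta : L) : subspace K 6 :=
  limg (linfun (fun x : L => bb_vec (alpha * x) (beta * x) 0)).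

Lemma spread_planeP (alpha beta : L) (v : 'rV[K]_7) :
  reflect (exists x, v = bb_vec (alpha * x) (beta * x) 0)
          (v \in spread_plane alpha beta).
Proof.
pose f (x : L) := bb_vec (alpha * x) (beta * x) 0.
have lin_f : linear f.
  move=> k x y; apply/rowP => i; rewrite /f /bb_vec !mxE.
  case: split => j; rewrite !mxE; last by rewrite mul0rn mulr0 addr0.
  by case: split => j'; rewrite !mxE mulrDr -scalerAr linearP.
pose fL := GRing.isLinear.Build _ _ _ _ f lin_f.
pose g : {linear L -> 'rV[K]_7} := HB.pack f fL.
have fE x : linfun f x = f x by rewrite -[f]/(g : L -> _) lfunE.
apply: (iffP memv_imgP) => [[x _ ->]|[x ->]]; exists x; rewrite ?memvf //.
Qed.

(* Q is the affine point of PG(6, q) corresponding to the affine point U, or Q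
   is one of the points of the spread plane [U] when U lies on l_oo. *)
Definition bruck_bose (U : subspace L 2) (Q : subspace K 6) : Prop :=
  (exists alpha beta : L,
     U = <[vec3 alpha beta 1%R]>%VS /\ Q = <[bb_vec alpha beta 1%R]>%VS) \/
  (exists alpha beta : L,
     [/\ (alpha, beta) != (0, 0), U = <[vec3 alpha beta 0%R]>%VS,
         \dim Q = 1%N & (Q <= spread_plane alpha beta)%VS]).

Definition bruck_bose_set (X : point_set L 2) : point_set K 6 :=
  fun Q => exists2 U, X U & bruck_bose U Q.

Definition extend_space (n : nat) (U : subspace K n) : subspace L n :=
  <<[seq map_mx (in_alg L) u | u <- vbasis U]>>%VS.

Definition is_transversal_line (g : subspace L 6) : Prop :=
  \dim g = 2%N /\
  forall alpha beta : L, (alpha, beta) != (0, 0) ->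
    (g :&: extend_space (spread_plane alpha beta))%VS != 0%VS.

End BruckBose.

(* A twisted cubic of a 3-space of PG(6, F) is the image of the standard one,
   { (s^3, s^2 t, s t^2, t^3) }, under a 4 x 7 matrix N of rank 4; it is handled
   through N, because for q < 5 its F-rational points alone do not determine
   the curve, hence neither its extension nor its tangents. *)
Section TwistedCubics.
Variable F : fieldType.

Definition cubic_vec (s t : F) : 'rV[F]_4 :=
  \row_(i < 4) (s ^+ (3 - i) * t ^+ i).

(* The partial derivatives of [cubic_vec] in s and t. *)
Definition cubic_vec_ds (s t : F) : 'rV[F]_4 :=
  \row_(i < 4) (s ^+ (2 - i) * t ^+ i *+ (3 - i)).

Definition cubic_vec_dt (s t : F) : 'rV[F]_4 :=
  \row_(i < 4) (s ^+ (3 - i) * t ^+ i.-1 *+ i).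

Definition is_twisted_cubic (N : 'M[F]_(4, 7)) : Prop := row_free N.

Definition cubic_space (N : 'M[F]_(4, 7)) : subspace F 6 :=
  (\sum_(i < 4) <[row i N]>)%VS.

Definition cubic_point (N : 'M[F]_(4, 7)) (s t : F) : subspace F 6 :=
  <[cubic_vec s t *m N]>%VS.

Definition cubic_points (N : 'M[F]_(4, 7)) : point_set F 6 :=
  fun Q => exists s t, (s, t) != (0, 0) /\ Q = cubic_point N s t.

(* The point itself is listed because in characteristic 3 the two partial
   derivatives are proportional; in other characteristics it is redundant by
   Euler's identity. *)
Definition cubic_tangent (N : 'M[F]_(4, 7)) (s t : F) : subspace F 6 :=
  <<[:: cubic_vec s t *m N; cubic_vec_ds s t *m N; cubic_vec_dt s t *m N]>>%VS.

End TwistedCubics.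

Section SpecialCubics.
Variables (K : finFieldType) (L : fieldExtType K) (tau : L).

Definition is_special_cubic (N : 'M[K]_(4, 7)) : Prop :=
  [/\ is_twisted_cubic N,
      ~~ (cubic_space N <= hyperplane_inf K 6)%VS,
      exists alpha beta : L, (alpha, beta) != (0, 0) /\
        (spread_plane tau alpha beta <= cubic_space N)%VS
    & forall g : subspace L 6, is_transversal_line tau g ->
        exists2 Q, cubic_points (map_mx (in_alg L) N) Q & (Q <= g)%VS].

(* m is the tangent at Q to the special twisted cubic whose set of points
   is C. *)
Definition is_special_tangent (C : point_set K 6) (Q m : subspace K 6) : Prop :=
  exists N : 'M[K]_(4, 7),
    [/\ is_special_cubic N,
        forall X, cubic_points N X <-> C X
      & exists s t,
          [/\ (s, t) != (0, 0), Q = cubic_point N s t & m = cubic_tangent N s t]].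

End SpecialCubics.

(* Main.v *)
Require Import Defs.
From HB Require Import structures.
From mathcomp Require Import all_boot all_order all_algebra all_field.
From mathcomp Require Import ring.

Set Implicit Arguments.
Unset Strict Implicit.
Unset Printing Implicit Defensive.

Import GRing.Theory.
Local Open Scope ring_scope.

(** Write [sigma] for the Frobenius map [x |-> x ^ q] of [F_(q^3)] over [F_q].
    The [q]-coordinates of PG(6, q) are traded for three [L]-valued ones: a
    vector of [K^7] is determined by [x], [y] in [L] and [z] in [K], and over
    [L] the linear forms [x], [sigma x], [sigma^2 x], [y], [sigma y],
    [sigma^2 y], [z] are coordinates on [L^7].  In these coordinates a spread
    plane extends to a subspace that is cut out separately in each conjugate
    pair [(sigma^j x, sigma^j y)], so the transversals are the three lines on
    which [z] and all but one of these pairs vanish ([tline_transversal],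
    [transversal_classification]).

    A twisted cubic is a point depending on [(s, t)] with cubic forms as
    coordinates.  If it meets the transversal of index 0 at the parameter
    [theta], then [x] and [y], whose conjugates of index 1 and 2 vanish at
    [theta], both have the factor [(s - sigma theta t) (s - sigma^2 theta t)],
    and [z], having coefficients in [K], is a multiple of the norm of
    [s - theta t] ([special_factored]).  Cancelling the common quadratic
    factor, the affine coordinates [x / z] and [y / z] become quotients of
    linear forms by [c = s c0 + t c1]: a special cubic without rational points
    at infinity is the image of a subline of PG(2, q^3).  Differentiating
    [(s a0 + t a1) / (s c0 + t c1)] shows that its tangent joins the point to
    the direction [(a0 c1 - c0 a1) / c^2] at infinity ([factored_tangent]).
    Two parametrizations of the same subline differ by a scalar of [L] and a
    matrix over [K], under which this direction only changes by a factor in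
    [K]: hence the tangent depends on the set of points alone
    ([special_tangentE]).  Conversely, multiplying numerators and denominator
    by the two conjugates of the denominator turns a subline into a special
    cubic ([special_cubic_exists]).

    Finally, if [p] is scaled so that [z p = 1] and [r] is another point of
    the subplane, the direction of the tangent at [p] to the cubic of the line
    [p r] is [(x r - z r * x p, y r - z r * y p)].  This is [K]-linear in [r]
    and its kernel is spanned by [p], so that all these directions fill a line
    at infinity, and the tangents lie in the plane joining it to [p]
    ([tangent_plane_exists]). *)

(** * Frobenius and conjugates in a cubic extension *)

Lemma quadratic_three_roots (F : fieldType) (x0 x1 x2 a b c : F) :
  a != b -> a != c -> b != c ->
  x0 + x1 * a + x2 * a ^+ 2 = 0 ->
  x0 + x1 * b + x2 * b ^+ 2 = 0 ->
  x0 + x1 * c + x2 * c ^+ 2 = 0 -> [/\ x0 = 0, x1 = 0 & x2 = 0].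
Proof.
rewrite -(subr_eq0 a) -(subr_eq0 a) -(subr_eq0 b) => ab ac bc ea eb ec.
have x20 : x2 = 0.
  have : (a - b) * ((a - c) * ((b - c) * x2)) = 0.
    transitivity ((b - c) * (x0 + x1 * a + x2 * a ^+ 2)
                  - (a - c) * (x0 + x1 * b + x2 * b ^+ 2)
                  + (a - b) * (x0 + x1 * c + x2 * c ^+ 2)); first by ring.
    by rewrite ea eb ec; ring.
  by move/eqP; rewrite !mulf_eq0 (negPf ab) (negPf ac) (negPf bc) => /eqP.
rewrite x20 in ea eb *.
have x10 : x1 = 0.
  have : (a - b) * x1 = 0.
    transitivity ((x0 + x1 * a + 0 * a ^+ 2) - (x0 + x1 * b + 0 * b ^+ 2)).
      by ring.
    by rewrite ea eb; ring.
  by move/eqP; rewrite mulf_eq0 (negPf ab) => /eqP.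
by split=> //; rewrite -ea x10; ring.
Qed.

Section Frobenius.
Variables (K : finFieldType) (L : fieldExtType K).

Definition frob (x : L) : L := x ^+ #|K|.

Fact frob_is_zmod_morphism : zmod_morphism frob.
Proof.
have [p _ pK] := finPcharP K.
have pL : p \in [pchar L] by rewrite pchar_lalg.
have pq : [pchar L].-nat #|K|.
  rewrite (eq_pnat _ (pcharf_eq pL)).
  by have := card_pprimeChar pK; rewrite /= => ->;
    rewrite pnatX pnat_id ?orbT ?(pcharf_prime pK).
move=> x y; rewrite /frob exprDn_pchar //; congr (_ + _).
apply/eqP; rewrite -addr_eq0 -exprDn_pchar // addNr expr0n.
by rewrite -[#|K|]prednK // (ltn_trans _ (finNzRing_gt1 K)).
Qed.

Fact frob_is_monoid_morphism : monoid_morphism frob.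
Proof. by split=> [|x y]; rewrite /frob ?expr1n ?exprMn. Qed.

HB.instance Definition _ := GRing.isZmodMorphism.Build L L frob
  frob_is_zmod_morphism.
HB.instance Definition _ := GRing.isMonoidMorphism.Build L L frob
  frob_is_monoid_morphism.

Lemma frob_alg (k : K) : frob k%:A = k%:A.
Proof. by rewrite /frob exprZn expr1n expf_card. Qed.

Lemma frob_fixed x : frob x = x -> exists k : K, x = k%:A.
Proof.
move=> fx; have : x \in (1%AS : {subfield L}).
  by rewrite finfield.Fermat's_little_theorem dimv1 expn1 -/(frob x) fx.
by case/vlineP=> k ->; exists k.
Qed.

Lemma frob3 (dimL : \dim {:L} = 3%N) x : frob (frob (frob x)) = x.
Proof.
have : x \in ({:L}%AS : {subfield L}) by rewrite memvf.
rewrite finfield.Fermat's_little_theorem dimL => /eqP xE.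
by rewrite -[RHS]xE /frob -!exprM !expnS expn0 muln1 mulnA.
Qed.
End Frobenius.

(** * Coordinates on the extension of PG(6, q) *)

Section Coordinates.
Variables (K : finFieldType) (L : fieldExtType K).
Variable tau : L.
Hypothesis dimL : \dim {:L} = 3%N.
Hypothesis tau_prim : ((#|K| ^ 3).-1)%N.-primitive_root tau.
Local Notation frob := (@frob K L).

(** An element moved by [frob] has three distinct conjugates, because [frob]
    has order 3. *)
Lemma frob_conj_neq x : frob x != x ->
  [/\ x != frob x, x != frob (frob x) & frob x != frob (frob x)].
Proof.
move=> fx; split; first by rewrite eq_sym.
  by apply: contra fx => /eqP xE; rewrite {1}xE frob3.
by rewrite (inj_eq (fmorph_inj _)) eq_sym.
Qed.

Lemma frob_tau : frob tau != tau.
Proof.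
have q1 := finNzRing_gt1 K.
apply/negP => /eqP tauq.
have : tau ^+ #|K|.-1 == 1.
  have tau0 : tau != 0.
    apply/eqP => t0; have /eqP := prim_expr_order tau_prim.
    by rewrite t0 expr0n eqn0Ngt (prim_order_gt0 tau_prim) eq_sym oner_eq0.
  by rewrite -(inj_eq (mulfI tau0)) -exprS prednK ?(ltnW q1) // mulr1
    -/(frob tau) tauq.
have q0 : (0 < #|K|.-1)%N by rewrite -ltnS prednK // (ltnW q1).
rewrite -(prim_order_dvd tau_prim) => /(dvdn_leq q0).
rewrite -ltnS !prednK ?expn_gt0 ?(ltnW q1) //.
by rewrite -[X in (_ <= X)%N]expn1 leq_exp2l.
Qed.

Lemma conj_tau : [/\ tau != frob tau, tau != frob (frob tau)
                   & frob tau != frob (frob tau)].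
Proof. exact/frob_conj_neq/frob_tau. Qed.

Lemma tau_basis : basis_of {:L} [tuple 1; tau; tau ^+ 2].
Proof.
rewrite basisEfree subvf dimL /= andbT.
apply/freeP => k; rewrite !big_ord_recl big_ord0 /= addr0 => k0.
have [t01 t02 t12] := conj_tau.
have e0 : (k ord0)%:A + (k (lift ord0 ord0))%:A * tau +
          (k (lift ord0 (lift ord0 ord0)))%:A * tau ^+ 2 = 0.
  by rewrite !mulr_algl -addrA.
have := congr1 frob e0; rewrite !(rmorphD, rmorphM, rmorphXn) rmorph0 /=
  !frob_alg => e1.
have := congr1 frob e1; rewrite !(rmorphD, rmorphM, rmorphXn) rmorph0 /=
  !frob_alg => e2.
have [/eqP + /eqP + /eqP] := quadratic_three_roots t01 t02 t12 e0 e1 e2.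
rewrite !scaler_eq0 oner_eq0 !orbF => /eqP z0 /eqP z1 /eqP z2.
by case=> -[|[|[|//]]] h; [rewrite -z0|rewrite -z1|rewrite -z2]; congr k;
  exact: val_inj.
Qed.

(** The six finite coordinates form two triples; [hx a] and [hy a] evaluate at
    [a] the quadratic polynomials that have these triples as coefficients.  At
    a conjugate of [tau] they give the conjugates of the two affine coordinates
    of PG(2, q^3). *)
Definition hx (a : L) (w : 'rV[L]_7) : L :=
  \sum_(i < 3) w 0 (lshift 1 (lshift 3 i)) * a ^+ i.

Definition hy (a : L) (w : 'rV[L]_7) : L :=
  \sum_(i < 3) w 0 (lshift 1 (rshift 3 i)) * a ^+ i.

Definition hz (F : fieldType) (w : 'rV[F]_7) : F := w 0 (rshift 6 ord0).

Fact hx_is_scalar a : scalar (hx a).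
Proof.
move=> k u v; rewrite /hx mulr_sumr -big_split; apply: eq_bigr => i _.
by rewrite !mxE mulrDl mulrA.
Qed.
Fact hy_is_scalar a : scalar (hy a).
Proof.
move=> k u v; rewrite /hy mulr_sumr -big_split; apply: eq_bigr => i _.
by rewrite !mxE mulrDl mulrA.
Qed.
Fact hz_is_scalar (F : fieldType) : scalar (@hz F).
Proof. by move=> k u v; rewrite /hz !mxE. Qed.
HB.instance Definition _ a := GRing.isLinear.Build L 'rV[L]_7 L _ (hx a)
  (hx_is_scalar a).
HB.instance Definition _ a := GRing.isLinear.Build L 'rV[L]_7 L _ (hy a)
  (hy_is_scalar a).
HB.instance Definition _ (F : fieldType) :=
  GRing.isLinear.Build F 'rV[F]_7 F _ (@hz F) (@hz_is_scalar F).

(** Evaluation of a quadratic polynomial at the three conjugates of [tau] is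
    injective, so [hx] and [hy] at these conjugates, together with [hz], form a
    full system of linear coordinates on [L^7]. *)
Lemma hxyz_eq0 w :
  (forall j, (j < 3)%N -> hx (iter j frob tau) w = 0 /\
    hy (iter j frob tau) w = 0) ->
  hz w = 0 -> w = 0.
Proof.
have [t01 t02 t12] := conj_tau.
have ev0 (f : 'I_3 -> L) :
    (forall j, (j < 3)%N -> \sum_i f i * iter j frob tau ^+ i = 0) ->
      forall i, f i = 0.
  move=> f0.
  have e j (j3 : (j < 3)%N) :
      f ord0 + f (lift ord0 ord0) * iter j frob tau +
      f (lift ord0 (lift ord0 ord0)) * iter j frob tau ^+ 2 = 0.
    by rewrite -(f0 j j3) !big_ord_recl big_ord0 /= /bump /=; ring.
  have [z0 z1 z2] := quadratic_three_roots t01 t02 t12 (e 0 isT) (e 1 isT)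
    (e 2 isT).
  by case=> -[|[|[|//]]] h; [rewrite -z0|rewrite -z1|rewrite -z2]; congr f;
    exact: val_inj.
move=> hxy z0; apply/rowP => i; rewrite mxE -(splitK (i : 'I_(6 + 1))).
case: (split _) => k /=; last by rewrite (ord1 k).
rewrite -(splitK (k : 'I_(3 + 3))); case: (split _) => {}k /=.
  by move: k; apply: ev0 => j /hxy[].
by move: k; apply: ev0 => j /hxy[].
Qed.

End Coordinates.

Section Extension.
Variables (K : finFieldType) (L : fieldExtType K).
Local Notation frob := (@frob K L).
Local Notation ext := (map_mx (in_alg L)).

Lemma iter_frobM j (x y : L) : iter j frob (x * y)
  = iter j frob x * iter j frob y.
Proof. by elim: j => //= j ->; rewrite rmorphM. Qed.

Lemma hx_ext j (a : L) (v : 'rV[K]_7) :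
  hx (iter j frob a) (ext v) = iter j frob (hx a (ext v)).
Proof.
elim: j => //= j <-; rewrite /hx rmorph_sum; apply: eq_bigr => i _.
by rewrite rmorphM rmorphXn !mxE /= frob_alg.
Qed.

Lemma hy_ext j (a : L) (v : 'rV[K]_7) :
  hy (iter j frob a) (ext v) = iter j frob (hy a (ext v)).
Proof.
elim: j => //= j <-; rewrite /hy rmorph_sum; apply: eq_bigr => i _.
by rewrite rmorphM rmorphXn !mxE /= frob_alg.
Qed.

Lemma hz_ext (v : 'rV[K]_7) : hz (ext v) = (hz v)%:A.
Proof. by rewrite /hz mxE. Qed.

Lemma mem_extend_space n (U : subspace K n) u : u \in U ->
  ext u \in extend_space L U.
Proof.
move=> /coord_vbasis ->; rewrite raddf_sum /=; apply: memv_suml => i _.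
rewrite map_mxZ memvZ //; apply: memv_span; apply/mapP.
by exists (vbasis U)`_i => //; rewrite mem_nth // size_tuple.
Qed.

Lemma extend_spaceP n (U : subspace K n) w : w \in extend_space L U ->
  exists (I : finType) (c : I -> L) (u : I -> 'rV[K]_n.+1),
    (forall i, u i \in U) /\ w = \sum_i c i *: ext (u i).
Proof.
pose s := map_tuple ext (vbasis U).
move=> ws; exists 'I_(\dim U), (fun i => coord s i w),
  (fun i : 'I__ => (vbasis U)`_i).
split=> [i|]; first by rewrite vbasis_mem // mem_nth // size_tuple.
have /coord_span {1}-> : w \in <<s>>%VS by [].
by apply: eq_bigr => i _; rewrite (nth_map 0) // size_tuple.
Qed.

End Extension.

Section BBvec.
Variables (K : finFieldType) (L : fieldExtType K).
Variable tau : L.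
Hypothesis dimL : \dim {:L} = 3%N.
Hypothesis tau_prim : ((#|K| ^ 3).-1)%N.-primitive_root tau.
Local Notation frob := (@frob K L).
Local Notation ext := (map_mx (in_alg L)).

(** The two [L]-valued coordinates of a rational vector; [bb_vec] is the inverse
    of the system they form with [hz]. *)
Definition kx (v : 'rV[K]_7) : L := hx tau (ext v).
Definition ky (v : 'rV[K]_7) : L := hy tau (ext v).

Fact kx_is_linear : linear kx.
Proof. by move=> k u v; rewrite /kx map_mxD map_mxZ linearD linearZ /=
  mulr_algl. Qed.
Fact ky_is_linear : linear ky.
Proof. by move=> k u v; rewrite /ky map_mxD map_mxZ linearD linearZ /=
  mulr_algl. Qed.
HB.instance Definition _ := GRing.isLinear.Build K 'rV[K]_7 L _ kx kx_is_linear.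
HB.instance Definition _ := GRing.isLinear.Build K 'rV[K]_7 L _ ky ky_is_linear.

Lemma coords_sum (alpha : L) :
  \sum_(i < 3) (coords tau alpha 0 i)%:A * tau ^+ i = alpha.
Proof.
rewrite [RHS](coord_basis (tau_basis dimL tau_prim) (memvf _)).
apply: eq_bigr => i _; rewrite mxE mulr_algl; congr (_ *: _).
by case: i => -[|[|[|//]]].
Qed.

Lemma kx_bb alpha beta z : kx (bb_vec tau alpha beta z) = alpha.
Proof.
rewrite -[RHS]coords_sum; apply: eq_bigr => i _.
rewrite mxE; congr (in_alg L _ * _).
exact: (etrans (row_mxEl _ _ _ _) (row_mxEl _ _ _ _)).
Qed.

Lemma ky_bb alpha beta z : ky (bb_vec tau alpha beta z) = beta.
Proof.
rewrite -[RHS]coords_sum; apply: eq_bigr => i _.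
rewrite mxE; congr (in_alg L _ * _).
exact: (etrans (row_mxEl _ _ _ _) (row_mxEr _ _ _ _)).
Qed.

Lemma hz_bb alpha beta z : hz (bb_vec tau alpha beta z) = z.
Proof. by apply: (etrans (row_mxEr _ _ _ _)); rewrite mxE. Qed.

Lemma kvec_inj u v : kx u = kx v -> ky u = ky v -> hz u = hz v -> u = v.
Proof.
move=> ex ey ez; apply/eqP; rewrite -subr_eq0 -(map_mx_eq0 (in_alg L));
  apply/eqP.
apply: (hxyz_eq0 dimL tau_prim) => [j _|].
  rewrite hx_ext hy_ext -/(kx _) -/(ky _) !linearB /= ex ey !subrr.
  by have -> : iter j frob 0 = 0 by elim: j => //= j ->; rewrite rmorph0.
by rewrite hz_ext linearB /= ez subrr scale0r.
Qed.

Lemma bb_vecDZ k a b z a' b' z' :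
  k *: bb_vec tau a b z + bb_vec tau a' b' z' =
  bb_vec tau (k *: a + a') (k *: b + b') (k * z + z').
Proof.
by apply: kvec_inj; rewrite linearD linearZ /= ?(kx_bb, ky_bb, hz_bb).
Qed.

Lemma bb_vecZ k a b z :
  k *: bb_vec tau a b z = bb_vec tau (k *: a) (k *: b) (k * z).
Proof.
by apply: kvec_inj; rewrite linearZ /= ?(kx_bb, ky_bb, hz_bb).
Qed.

(** Each of the three conditions on [w] only involves one conjugate pair of
    coordinates: this is what singles out the transversals. *)
Lemma extend_spread alpha beta w : w \in extend_space L
  (spread_plane tau alpha beta) ->
  hz w = 0 /\ forall j, iter j frob beta * hx (iter j frob tau) w =
                        iter j frob alpha * hy (iter j frob tau) w.
Proof.
move=> /extend_spaceP[I [c [u [/(_ _)/spread_planeP uP ->]]]]; split.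
  rewrite linear_sum big1 // => i _; have [x ->] := uP i.
  by rewrite linearZ /= hz_ext hz_bb scale0r mulr0.
move=> j; rewrite !linear_sum !mulr_sumr; apply: eq_bigr => i _.
have [x ->] := uP i.
rewrite !linearZ /= hx_ext hy_ext -/(kx _) -/(ky _) kx_bb ky_bb !iter_frobM;
  ring.
Qed.
End BBvec.

(** * The transversals of the spread *)

Section Span2.
Variables (F : fieldType) (V : vectType F).
Implicit Types u v w : V.

Lemma span2P u v w :
  reflect (exists a b, w = a *: u + b *: v) (w \in <<[:: u; v]>>%VS).
Proof.
rewrite span_cons span_seq1; apply: (iffP memv_addP) =>
  [[x /vlineP[a ->]]|[a [b ->]]].
  by case=> y /vlineP[b ->] ->; exists a, b.
by exists (a *: u); rewrite ?memvZ ?memv_line //; exists (b *: v);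
  rewrite ?memvZ ?memv_line.
Qed.

Lemma dim_span2 u v : (forall a b, a *: u + b *: v = 0 -> a = 0 /\ b = 0) ->
  \dim <<[:: u; v]>> = 2%N.
Proof.
move=> uv; apply/eqP; rewrite -[_ == _]/(free _) free_cons span_seq1 seq1_free.
apply/andP; split; last first.
  apply/eqP => v0; have [_ /eqP] : (0 : F) = 0 /\ (1 : F) = 0.
    by apply: uv; rewrite v0 scale0r scaler0 addr0.
  by rewrite oner_eq0.
apply/vlineP => -[k uE]; have [] := uv 1 (- k);
  first by rewrite uE scale1r scaleNr subrr.
by move/eqP; rewrite oner_eq0.
Qed.
End Span2.

Section Transversals.
Variables (K : finFieldType) (L : fieldExtType K).
Variable tau : L.
Hypothesis dimL : \dim {:L} = 3%N.
Hypothesis tau_prim : ((#|K| ^ 3).-1)%N.-primitive_root tau.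
Local Notation frob := (@frob K L).
Local Notation ext := (map_mx (in_alg L)).
Local Notation tau_ j := (iter j frob tau).

(** The coefficients of [(X - frob tau) * (X - frob (frob tau))]: as this kills
    the conjugates of index 1 and 2 of [tau], only the conjugate pair of index 0
    of the vector [tline_vec alpha beta] can be nonzero. *)
Let lagrange : 'I_3 -> L :=
  nth 0 [:: frob tau * frob (frob tau); - (frob tau + frob (frob tau)); 1].

Definition tline_vec (alpha beta : L) : 'rV[L]_7 :=
  \sum_(i < 3) lagrange i *: ext (bb_vec tau (alpha * tau ^+ i)
    (beta * tau ^+ i) 0).

Let delta := (tau - frob tau) * (tau - frob (frob tau)).

Let delta_neq0 : delta != 0.
Proof.
by have [t01 t02 _] := conj_tau dimL tau_prim; rewrite mulf_neq0 ?subr_eq0.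
Qed.

Let lagrangeE j (alpha : L) : (j < 3)%N ->
  \sum_(i < 3) lagrange i * iter j frob (alpha * tau ^+ i) =
  if j == 0%N then alpha * delta else 0.
Proof.
move=> j3.
have X x i : iter j frob (x ^+ i) = iter j frob x ^+ i.
  by elim: (j) => //= k ->; rewrite rmorphXn.
rewrite !big_ord_recl big_ord0 /= !iter_frobM !X /lagrange /= /delta.
by case: j j3 {X} => [|[|[|//]]] _ /=; ring.
Qed.

Lemma hx_tline_vec j alpha beta : (j < 3)%N ->
  hx (tau_ j) (tline_vec alpha beta) = if j == 0%N then alpha * delta else 0.
Proof.
move=> j3; rewrite -lagrangeE // linear_sum; apply: eq_bigr => i _.
by rewrite linearZ /= hx_ext -/(kx _ _) kx_bb.
Qed.

Lemma hy_tline_vec j alpha beta : (j < 3)%N ->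
  hy (tau_ j) (tline_vec alpha beta) = if j == 0%N then beta * delta else 0.
Proof.
move=> j3; rewrite -lagrangeE // linear_sum; apply: eq_bigr => i _.
by rewrite linearZ /= hy_ext -/(ky _ _) ky_bb.
Qed.

Lemma hz_tline_vec alpha beta : hz (tline_vec alpha beta) = 0.
Proof.
rewrite linear_sum big1 // => i _.
by rewrite linearZ /= hz_ext hz_bb scale0r mulr0.
Qed.

Lemma tline_vecE alpha beta :
  tline_vec alpha beta =
  alpha *: tline_vec 1 0 + beta *: tline_vec 0 1.
Proof.
apply/eqP; rewrite -subr_eq0; apply/eqP;
  apply: (hxyz_eq0 dimL tau_prim) => [j j3|].
  rewrite !(linearB, linearD, linearZ) /= !hx_tline_vec ?hy_tline_vec //.
  by split; case: eqP => _; ring.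
by rewrite !(linearB, linearD, linearZ) /= !hz_tline_vec; ring.
Qed.

Definition tline : subspace L 6 :=
  <<[:: tline_vec 1 0; tline_vec 0 1]>>%VS.

Lemma tline_vec_eq0 alpha beta :
  tline_vec alpha beta = 0 -> alpha = 0 /\ beta = 0.
Proof.
move=> t0; have := hx_tline_vec alpha beta (isT : (0 < 3)%N).
have := hy_tline_vec alpha beta (isT : (0 < 3)%N).
rewrite t0 !linear0 /= => /esym/eqP + /esym/eqP.
by rewrite !(mulf_eq0 _ delta) (negPf delta_neq0) !orbF => /eqP -> /eqP ->.
Qed.

Lemma tline_transversal : is_transversal_line tau tline.
Proof.
split=> [|alpha beta ab0].
  by apply: dim_span2 => a b; rewrite -tline_vecE => /tline_vec_eq0.
apply: contra ab0 => /eqP cap0.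
suff : tline_vec alpha beta \in 0%VS.
  by rewrite memv0 => /eqP/tline_vec_eq0[-> ->].
rewrite -cap0 memv_cap; apply/andP; split.
  by apply/span2P; exists alpha, beta; rewrite tline_vecE.
apply: memv_suml => i _; rewrite memvZ // mem_extend_space //.
by apply/spread_planeP; exists (tau ^+ i).
Qed.

Lemma mem_tline w : w \in tline ->
  hz w = 0 /\ forall j, (j < 3)%N -> j != 0%N ->
    hx (tau_ j) w = 0 /\ hy (tau_ j) w = 0.
Proof.
move=> /span2P[a [b]]; rewrite -tline_vecE => ->.
split=> [|j j3 /negPf j0]; first exact: hz_tline_vec.
by rewrite hx_tline_vec // hy_tline_vec // j0.
Qed.

Let tau_inj i j : (i < 3)%N -> (j < 3)%N -> tau_ i = tau_ j -> i = j.
Proof.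
have [/eqP t01 /eqP t02 /eqP t12] := conj_tau dimL tau_prim.
case: i j => [|[|[|//]]] [|[|[|//]]] //= _ _ e.
all: by first [case: t01; done | case: t02; done | case: t12; done].
Qed.

Lemma hxy_neq0 w : w != 0 -> hz w = 0 ->
  exists2 j, (j < 3)%N & (hx (tau_ j) w != 0) || (hy (tau_ j) w != 0).
Proof.
move=> w0 z0; have [/existsP[j jP]|/existsPn allN] :=
  boolP [exists j : 'I_3, (hx (tau_ j) w != 0) || (hy (tau_ j) w != 0)].
  by exists j.
case/eqP: w0; apply: (hxyz_eq0 dimL tau_prim) => // j j3.
by have := allN (Ordinal j3); rewrite negb_or !negbK => /andP[/eqP -> /eqP ->].
Qed.

(** The points [u] and [v] in which [g] meets the spread planes of [(1, 0)] and
    [(0, 1)] span [g].  Meeting the plane of [(1, 1)] makes the [hx]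
    coordinates of [u] proportional to the [hy] coordinates of [v], and meeting
    the one of [(1, tau)] forces all indices at which they are nonzero to give
    the same conjugate of [tau], so that there is only one such index. *)
Lemma transversal_classification g : is_transversal_line tau g ->
  exists2 j, (j < 3)%N & forall w, hz w = 0 ->
    (forall k, (k < 3)%N -> k != j -> hx (tau_ k) w = 0 /\ hy (tau_ k) w = 0) ->
    w \in g.
Proof.
case=> dim_g meet.
have pick (alpha beta : L) : (alpha, beta) != (0, 0) ->
  exists w, [/\ w \in g, w != 0, hz w = 0
    & forall j, iter j frob beta * hx (tau_ j) w
      = iter j frob alpha * hy (tau_ j) w].
  move=> /meet; rewrite -vpick0 => w0;
    exists (vpick (g :&: extend_space L (spread_plane tau alpha beta))).
  by have := memv_pick (g :&: extend_space L (spread_plane tau alpha beta));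
     rewrite memv_cap => /andP[wg /(extend_spread dimL tau_prim)[]].
have it0 j : iter j frob 0 = 0 by elim: j => //= j ->; rewrite rmorph0.
have it1 j : iter j frob 1 = 1 by elim: j => //= j ->; rewrite rmorph1.
have n10 : ((1 : L), (0 : L)) != (0, 0) by rewrite xpair_eqE oner_eq0.
have n01 : ((0 : L), (1 : L)) != (0, 0) by rewrite xpair_eqE oner_eq0 andbF.
have n11 (x : L) : ((1 : L), x) != (0, 0) by rewrite xpair_eqE oner_eq0.
have [u [ug u0 uz uE]] := pick 1 0 n10.
have [v [vg v0 vz vE]] := pick 0 1 n01.
have uy j : hy (tau_ j) u = 0 by have := uE j; rewrite it0 it1 mul0r mul1r.
have vx j : hx (tau_ j) v = 0 by have := vE j; rewrite it0 it1 mul0r mul1r.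
have [j j3] := hxy_neq0 u0 uz; rewrite uy eqxx orbF => uj0.
have [i i3] := hxy_neq0 v0 vz; rewrite vx eqxx /= => vi0.
have gE : g = <<[:: u; v]>>%VS.
  apply/esym/eqP; rewrite eqEdim; apply/andP; split.
    by apply/span_subvP => x; rewrite !inE => /orP[]/eqP ->.
  rewrite dim_g dim_span2 // => a b ab0.
  have := congr1 (hx (tau_ j)) ab0; have := congr1 (hy (tau_ i)) ab0.
  rewrite !(linearD, linearZ, linear0) /= uy vx !mulr0 addr0 add0r =>
    /eqP + /eqP.
  by rewrite !mulf_eq0 (negPf uj0) (negPf vi0) !orbF => /eqP -> /eqP ->.
have [w1 [w1g w10 _ w1E]] := pick 1 1 (n11 1).
have [w2 [w2g w20 _ w2E]] := pick 1 tau (n11 tau).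
move: w1g w2g; rewrite gE => /span2P[a [b w1D]] /span2P[c [d w2D]].
have {}w1E k : a * hx (tau_ k) u = b * hy (tau_ k) v.
  by have := w1E k; rewrite !it1 !mul1r w1D !(linearD, linearZ) /= uy vx
    !mulr0 addr0 add0r.
have {}w2E k : tau_ k * (c * hx (tau_ k) u) = d * hy (tau_ k) v.
  by have := w2E k; rewrite !it1 !mul1r w2D !(linearD, linearZ) /= uy vx
    !mulr0 addr0 add0r.
have b0 : b != 0.
  apply: contra w10 => /eqP b0; rewrite w1D b0 scale0r addr0.
  have /eqP := w1E j; rewrite b0 mul0r mulf_eq0 (negPf uj0) orbF => /eqP ->.
  by rewrite scale0r.
have a0 : a != 0.
  by apply: contra b0 => /eqP a0; have /esym/eqP := w1E i;
    rewrite a0 mul0r mulf_eq0 (negPf vi0) orbF.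
have ca k : hx (tau_ k) u != 0 -> c * b * tau_ k = d * a.
  move=> uk; apply: (mulIf uk).
  transitivity (b * (tau_ k * (c * hx (tau_ k) u))); first by ring.
  rewrite w2E; transitivity (d * (b * hy (tau_ k) v)); first by ring.
  by rewrite -w1E; ring.
have c0 : c != 0.
  apply: contra w20 => /eqP c0; have /esym/eqP := ca j uj0.
  by rewrite w2D c0 !mul0r mulf_eq0 (negPf a0) orbF => /eqP ->;
    rewrite !scale0r addr0.
have uk0 k : (k < 3)%N -> k != j -> hx (tau_ k) u = 0.
  move=> k3 kj; apply/eqP; apply: contraNT kj => uk; apply/eqP/tau_inj => //.
  by apply: (mulfI (mulf_neq0 c0 b0)); rewrite !ca.
have vk0 k : (k < 3)%N -> k != j -> hy (tau_ k) v = 0.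
  move=> k3 kj; have /esym/eqP := w1E k.
  by rewrite uk0 // mulr0 mulf_eq0 (negPf b0) => /eqP.
have vj0 : hy (tau_ j) v != 0.
  have : a * hx (tau_ j) u != 0 by rewrite mulf_neq0.
  by rewrite w1E mulf_eq0 (negPf b0).
exists j => // w wz wk; apply/span2P.
exists (hx (tau_ j) w / hx (tau_ j) u), (hy (tau_ j) w / hy (tau_ j) v).
apply/eqP; rewrite -subr_eq0; apply/eqP;
  apply: (hxyz_eq0 dimL tau_prim) => [k k3|].
  rewrite !(linearB, linearD, linearZ) /= uy vx.
  have [->|kj] := eqVneq k j; first by rewrite !divfK //; split; ring.
  by have [-> ->] := wk k k3 kj; rewrite (uk0 k) // (vk0 k) //; split; ring.
by rewrite !(linearB, linearD, linearZ) /= wz uz vz; ring.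
Qed.
End Transversals.

(** * Twisted cubics and their tangents *)

Lemma hyperplane_infP (F : fieldType) n (v : 'rV[F]_n.+1) :
  reflect (v 0 ord_max = 0) (v \in hyperplane_inf F n).
Proof.
apply: (iffP idP) => [/memv_sumP[w wP ->]|v0].
  rewrite summxE big1 // => i i_max; have /vlineP[k ->] := wP i i_max.
  by rewrite !mxE eqxx eq_sym (negPf i_max) mulr0.
rewrite (row_sum_delta v) (bigD1 ord_max) //= v0 scale0r add0r.
by apply: memv_sumr => i _; rewrite memvZ // memv_line.
Qed.

Section CubicRows.
Variable F : fieldType.
Implicit Type N : 'M[F]_(4, 7).

Definition nrow N (k : nat) : 'rV[F]_7 := row (inord k) N.
Arguments nrow N k%_N.

Lemma mulmx_nrow N (v : 'rV_4) : v *m N =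
  v 0 (inord 0) *: nrow N 0 + v 0 (inord 1) *: nrow N 1
  + v 0 (inord 2) *: nrow N 2 + v 0 (inord 3) *: nrow N 3.
Proof.
rewrite mulmx_sum_row (eq_bigr (fun i : 'I_4 => v 0 (inord i) *: nrow N i)).
  by rewrite !big_ord_recl big_ord0 addr0 !addrA.
by move=> i _; rewrite /nrow inord_val.
Qed.

Lemma cubic_vecE N s t : cubic_vec s t *m N =
  s ^+ 3 *: nrow N 0 + (s ^+ 2 * t) *: nrow N 1 + (s * t ^+ 2) *: nrow N 2
  + t ^+ 3 *: nrow N 3.
Proof. by rewrite mulmx_nrow !mxE !inordK //= expr0 mulr1 mul1r. Qed.

Lemma cubic_vec_dsE N s t : cubic_vec_ds s t *m N =
  (3%:R * s ^+ 2) *: nrow N 0 + (2%:R * s * t) *: nrow N 1 + t ^+ 2 *: nrow N 2.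
Proof.
rewrite mulmx_nrow !mxE !inordK //= mulr0n scale0r addr0.
by congr (_ *: _ + _ *: _ + _ *: _); rewrite /subn /subn_rec /=; ring.
Qed.

Lemma cubic_vec_dtE N s t : cubic_vec_dt s t *m N =
  s ^+ 2 *: nrow N 1 + (2%:R * s * t) *: nrow N 2 + (3%:R * t ^+ 2) *: nrow N 3.
Proof.
rewrite mulmx_nrow !mxE !inordK //= mulr0n scale0r add0r.
by congr (_ *: _ + _ *: _ + _ *: _); rewrite /subn /subn_rec /=; ring.
Qed.

Lemma row_free_nrow03 N a b : row_free N -> a *: nrow N 0 + b *: nrow N 3 = 0 ->
  a = 0 /\ b = 0.
Proof.
move=> /row_free_inj N_inj; rewrite /nrow !rowE !scalemxAl -mulmxDl
  -[RHS](mul0mx _ N).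
move/N_inj/rowP => e.
have := e (inord 0); have := e (inord 3).
rewrite !mxE !eqxx /= -!val_eqE /= !inordK //= !mulr1 !mulr0 addr0 add0r.
by move=> -> ->.
Qed.

(** The cubic forms handled below are products of a linear form [u s + v t] by
    a quadratic form [s ^ 2 + m1 s t + m2 t ^ 2]; these are the coefficients of
    such a product. *)
Definition has_factor (R : pzRingType) (f : nat -> R) (u v m1 m2 : R) :=
  [/\ f 0%N = u, f 1%N = v + m1 * u, f 2%N = m2 * u + m1 * v & f 3%N = m2 * v].

(** Dividing by the quadratic with roots [d] and [e] leaves a remainder of
    degree at most one with two distinct roots. *)
Lemma cubic_two_roots (f : nat -> F) d e : d != e ->
  (forall x, x = d \/ x = e ->
     x ^+ 3 * f 0%N + x ^+ 2 * f 1%N + x * f 2%N + f 3%N = 0) ->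
  exists v, has_factor f (f 0%N) v (- (d + e)) (d * e).
Proof.
rewrite -subr_eq0 => de root.
have rd := root d (or_introl erefl); have re := root e (or_intror erefl).
have f2 : f 2%N = d * e * f 0%N + - (d + e) * (f 1%N + f 0%N * (d + e)).
  apply/(mulfI de)/eqP; rewrite -subr_eq0; apply/eqP.
  transitivity ((d ^+ 3 * f 0%N + d ^+ 2 * f 1%N + d * f 2%N + f 3%N) -
                (e ^+ 3 * f 0%N + e ^+ 2 * f 1%N + e * f 2%N + f 3%N));
                  first by ring.
  by rewrite rd re subrr.
exists (f 1%N + f 0%N * (d + e)); split=> //; first by ring.
by apply/eqP; rewrite -subr_eq0 -rd f2; apply/eqP; ring.
Qed.

End CubicRows.

Section SpecialCubics.
Variables (K : finFieldType) (L : fieldExtType K).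
Variable tau : L.
Hypothesis dimL : \dim {:L} = 3%N.
Hypothesis tau_prim : ((#|K| ^ 3).-1)%N.-primitive_root tau.
Local Notation frob := (@frob K L).
Local Notation ext := (map_mx (in_alg L)).
Local Notation kx := (kx tau).
Local Notation ky := (ky tau).
Local Notation bb := (bb_vec tau).

Lemma nrow_ext (N : 'M[K]_(4, 7)) k : nrow (ext N) k = ext (nrow N k).
Proof. by rewrite /nrow map_row. Qed.

(** The cubic forms giving the coordinates [x], [y] and [z] of the cubic [N] are
    [s u + t v], [s u' + t v'] and [s x + t y], all times the same quadratic
    form. *)
Definition factored N u v u' v' x y m1 m2 :=
  [/\ has_factor (fun k => kx (nrow N k)) u v m1 m2,
      has_factor (fun k => ky (nrow N k)) u' v' m1 m2
    & has_factor (fun k => (hz (nrow N k))%:A : L) x y m1 m2].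

Lemma algM (a b : K) : (a * b)%:A = a%:A * b%:A :> L.
Proof. exact: (rmorphM (in_alg L)). Qed.
Lemma algX (a : K) n : (a ^+ n)%:A = a%:A ^+ n :> L.
Proof. exact: (rmorphXn (in_alg L)). Qed.
Lemma algn n : (n%:R : K)%:A = n%:R :> L.
Proof. exact: (rmorph_nat (in_alg L)). Qed.
Lemma algD (a b : K) : (a + b)%:A = a%:A + b%:A :> L.
Proof. exact: (rmorphD (in_alg L)). Qed.
Lemma alg_eq0 (a : K) : (a%:A == 0 :> L) = (a == 0).
Proof. exact: (fmorph_eq0 (in_alg L)). Qed.

Lemma kxZ (a : K) v : kx (a *: v) = a%:A * kx v.
Proof. by rewrite linearZ mulr_algl. Qed.
Lemma kyZ (a : K) v : ky (a *: v) = a%:A * ky v.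
Proof. by rewrite linearZ mulr_algl. Qed.

Definition algE := (algM, algX, algn, algD).

(** With [M] the common quadratic factor and [F = Z P], the partial derivatives
    of [F] are [Z_s P + t Z D] and [Z_t P - s Z D]: the derivatives of [M] only
    contribute multiples of [P], and [D] comes from the quotient rule. *)
Lemma factored_tangent N u v u' v' x y m1 m2 (s t : K) :
  factored N u v u' v' x y m1 m2 -> (s, t) != (0, 0) ->
  hz (cubic_vec s t *m N) != 0 ->
  let c := s%:A * x + t%:A * y in
  let P := bb ((s%:A * u + t%:A * v) / c) ((s%:A * u' + t%:A * v') / c) 1 in
  let D := bb ((u * y - x * v) / c ^+ 2) ((u' * y - x * v') / c ^+ 2) 0 in
  [/\ c != 0, cubic_point N s t = <[P]>%VS & cubic_tangent N s t
    = <<[:: P; D]>>%VS].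
Proof.
move=> [[x0 x1 x2 x3] [y0 y1 y2 y3] [z0 z1 z2 z3]] st0 Z0 c P D.
set S := s%:A : L; set T := t%:A : L;
  pose M := S ^+ 2 + m1 * (S * T) + m2 * T ^+ 2.
set Z := hz (cubic_vec s t *m N) in Z0.
pose Zs := hz (cubic_vec_ds s t *m N); pose Zt := hz (cubic_vec_dt s t *m N).
have ZE : Z%:A = c * M.
  rewrite /Z cubic_vecE !(linearD, linearZ) /= !algE z0 z1 z2 z3 -/S -/T /c /M;
    ring.
have ZsE : Zs%:A = x * M + c * (2%:R * S + m1 * T).
  rewrite /Zs cubic_vec_dsE !(linearD, linearZ) /= !algE z0 z1 z2 -/S -/T /c
    /M; ring.
have ZtE : Zt%:A = y * M + c * (m1 * S + 2%:R * m2 * T).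
  rewrite /Zt cubic_vec_dtE !(linearD, linearZ) /= !algE z1 z2 z3 -/S -/T /c
    /M; ring.
have : c * M != 0 by rewrite -ZE alg_eq0.
rewrite mulf_eq0 negb_or => /andP[c0 M0].
have FE : cubic_vec s t *m N = Z *: P.
  apply: (kvec_inj dimL tau_prim); rewrite ?kxZ ?kyZ ?linearZ /= ?kx_bb ?ky_bb
    ?hz_bb ?mulr1 //.
    rewrite cubic_vecE !linearD /= ?kxZ ?kyZ !algE x0 x1 x2 x3 ZE -/S -/T /M.
    by field.
  rewrite cubic_vecE !linearD /= ?kxZ ?kyZ !algE y0 y1 y2 y3 ZE -/S -/T /M.
  by field.
have FsE : cubic_vec_ds s t *m N = Zs *: P + (t * Z) *: D.
  apply: (kvec_inj dimL tau_prim);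
    rewrite ?linearD /= ?kxZ ?kyZ ?linearZ /= ?kx_bb ?ky_bb ?hz_bb ?mulr1
      ?mulr0 ?addr0 //.
    rewrite cubic_vec_dsE !linearD /= ?kxZ ?kyZ !algE x0 x1 x2 ZE ZsE.
    by rewrite -/S -/T /M /c -/S -/T; field; exact: c0.
  rewrite cubic_vec_dsE !linearD /= ?kxZ ?kyZ !algE y0 y1 y2 ZE ZsE.
  by rewrite -/S -/T /M /c -/S -/T; field; exact: c0.
have FtE : cubic_vec_dt s t *m N = Zt *: P - (s * Z) *: D.
  apply: (kvec_inj dimL tau_prim);
    rewrite ?linearB /= ?kxZ ?kyZ ?linearZ /= ?kx_bb ?ky_bb ?hz_bb ?mulr1
      ?mulr0 ?subr0 //.
    rewrite cubic_vec_dtE !linearD /= ?kxZ ?kyZ !algE x1 x2 x3 ZE ZtE.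
    by rewrite -/S -/T /M /c -/S -/T; field; exact: c0.
  rewrite cubic_vec_dtE !linearD /= ?kxZ ?kyZ !algE y1 y2 y3 ZE ZtE.
  by rewrite -/S -/T /M /c -/S -/T; field; exact: c0.
split=> //.
  rewrite /cubic_point FE; apply/eqP;
    rewrite eqEsubv -!memvE memvZ ?memv_line //=.
  by rewrite -{1}[P](scalerK Z0) memvZ ?memv_line.
have PD a b : a *: P + b *: D \in <<[:: P; D]>>%VS by apply/span2P; exists a, b.
apply/eqP; rewrite eqEsubv; apply/andP; split; apply/span_subvP => w.
  rewrite !inE FE FsE FtE => /or3P[] /eqP ->; rewrite ?PD //.
    by rewrite -[Z *: P]addr0 -(scale0r D) PD.
  by rewrite -scaleNr PD.
set Tg := cubic_tangent N s t.
have FT : cubic_vec s t *m N \in Tg by apply: memv_span; rewrite !inE eqxx.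
have FsT : cubic_vec_ds s t *m N \in Tg by apply: memv_span;
  rewrite !inE eqxx orbT.
have FtT : cubic_vec_dt s t *m N \in Tg by apply: memv_span;
  rewrite !inE eqxx !orbT.
have PT : P \in Tg by rewrite -[P](scalerK Z0) -FE memvZ.
rewrite !inE => /orP[] /eqP -> //.
have [t0|t0] := eqVneq t 0.
  have s0 : s != 0 by move: st0; rewrite t0 xpair_eqE eqxx andbT.
  rewrite -[D](scalerK (mulf_neq0 s0 Z0)) memvZ //.
  by rewrite (_ : _ *: D = Zt *: P - cubic_vec_dt s t *m N) ?rpredB ?memvZ //
    FtE opprB addrC subrK.
rewrite -[D](scalerK (mulf_neq0 t0 Z0)) memvZ //.
by rewrite (_ : _ *: D = cubic_vec_ds s t *m N - Zs *: P) ?rpredB ?memvZ //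
  FsE addrAC subrr add0r.
Qed.

(** Frobenius conjugates the condition that the cubic meets one transversal
    into the factorization of its coordinates. *)
Lemma special_factored N : is_special_cubic tau N ->
  (forall s t, (s, t) != (0, 0) -> hz (cubic_vec s t *m N) != 0) ->
  exists u v u' v' x y m1 m2, factored N u v u' v' x y m1 m2 /\ x != 0.
Proof.
move=> [_ _ _ /(_ _ (tline_transversal dimL tau_prim))[Q [s0 [t0 [st0 ->]]]]].
rewrite -memvE => /(mem_tline dimL tau_prim)[wz wh] Zn0.
have {wh} [[w1x w1y] [w2x w2y]] := (wh 1%N isT isT, wh 2%N isT isT).
have Z0 : hz (nrow N 0) != 0.
  have := Zn0 1 0; rewrite cubic_vecE !(linearD, linearZ) /= xpair_eqE
    oner_eq0 => /(_ isT).
  by congr (_ != 0); ring.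
have FE (f : {scalar 'rV[L]_7}) : f (cubic_vec s0 t0 *m ext N) =
    s0 ^+ 3 * f (ext (nrow N 0)) + s0 ^+ 2 * t0 * f (ext (nrow N 1))
    + s0 * t0 ^+ 2 * f (ext (nrow N 2)) + t0 ^+ 3 * f (ext (nrow N 3)).
  by rewrite cubic_vecE !nrow_ext !(linearD, linearZ).
(* Otherwise the form [z], which has no rational root, vanishes at (1, 0). *)
have t00 : t0 != 0.
  apply/eqP => t00.
  have s00 : s0 != 0 by move: st0; rewrite t00 xpair_eqE eqxx andbT.
  have /eqP := wz; rewrite (FE (@hz L)) t00 /= !hz_ext !expr0n !mulr0 !mul0r
    !addr0.
  by rewrite mulf_eq0 expf_eq0 (negPf s00) /= alg_eq0 (negPf Z0).
pose theta := s0 / t0.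
have root_theta (f : {scalar 'rV[L]_7}) : f (cubic_vec s0 t0 *m ext N) = 0 ->
    theta ^+ 3 * f (ext (nrow N 0)) + theta ^+ 2 * f (ext (nrow N 1))
    + theta * f (ext (nrow N 2)) + f (ext (nrow N 3)) = 0.
  rewrite FE => e; apply: (mulfI (expf_neq0 3 t00)); rewrite mulr0 -e /theta.
  by field.
have {}w1x := root_theta (hx (iter 1 frob tau)) w1x.
have {}w1y := root_theta (hy (iter 1 frob tau)) w1y.
have {}w2x := root_theta (hx (iter 2 frob tau)) w2x.
have {}w2y := root_theta (hy (iter 2 frob tau)) w2y.
have {}wz := root_theta (@hz L) wz.
have hx1 a v : hx (frob a) (ext v) = frob (hx a (ext v)) := hx_ext 1 a v.
have hy1 a v : hy (frob a) (ext v) = frob (hy a (ext v)) := hy_ext 1 a v.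
rewrite /= !(hx1, hy1) -!/(kx _) -!/(ky _) in w1x w1y w2x w2y.
rewrite /= !hz_ext in wz.
have frobK : frob theta != theta.
  apply/eqP => /frob_fixed[k kE]; have := Zn0 k 1.
  rewrite xpair_eqE oner_eq0 andbF => /(_ isT);
    rewrite -(alg_eq0 (hz _)) -wz kE.
  rewrite cubic_vecE !(linearD, linearZ) /= !algE scale1r.
  by rewrite !(mulr1, mul1r, expr1n) eqxx.
have [d0 e0 de] := frob_conj_neq dimL frobK.
have frob_poly z (a b c d : L) : frob (z ^+ 3 * a + z ^+ 2 * b + z * c + d) =
    frob z ^+ 3 * frob a + frob z ^+ 2 * frob b + frob z * frob c + frob d.
  by rewrite !(rmorphD, rmorphM, rmorphXn).
clearbody theta.
have root2 (f : nat -> L) :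
    theta ^+ 3 * frob (f 0%N) + theta ^+ 2 * frob (f 1%N) + theta * frob
      (f 2%N) + frob (f 3%N) = 0 ->
    theta ^+ 3 * frob (frob (f 0%N)) + theta ^+ 2 * frob (frob (f 1%N))
      + theta * frob (frob (f 2%N)) + frob (frob (f 3%N)) = 0 ->
    exists v, has_factor f (f 0%N) v (- (frob theta + frob (frob theta)))
                (frob theta * frob (frob theta)).
  move=> e1 e2; apply: cubic_two_roots => // z [->|->].
    have := congr1 frob e2; by rewrite frob_poly !(frob3 dimL) => ->;
      rewrite rmorph0.
  have := congr1 frob (congr1 frob e1); rewrite !frob_poly !(frob3 dimL) => ->.
  by rewrite !rmorph0.
have [v vP] := root2 (fun k => kx (nrow N k)) w1x w2x.
have [v' v'P] := root2 (fun k => ky (nrow N k)) w1y w2y.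
have [y yP] : exists y, has_factor (fun k => (hz (nrow N k))%:A : L)
   (hz (nrow N 0))%:A y (- (frob theta + frob (frob theta)))
     (frob theta * frob (frob theta)).
  by apply: (root2 (fun k => (hz (nrow N k))%:A)); rewrite !frob_alg.
exists (kx (nrow N 0)), v, (ky (nrow N 0)), v', (hz (nrow N 0))%:A, y.
exists (- (frob theta + frob (frob theta))), (frob theta * frob (frob theta)).
by split; rewrite ?alg_eq0.
Qed.

End SpecialCubics.

(** * The special cubic of a subline *)

Section Subline.
Variables (K : finFieldType) (L : fieldExtType K).
Variable tau : L.
Hypothesis dimL : \dim {:L} = 3%N.
Hypothesis tau_prim : ((#|K| ^ 3).-1)%N.-primitive_root tau.
Local Notation frob := (@frob K L).
Local Notation ext := (map_mx (in_alg L)).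
Local Notation kx := (kx tau).
Local Notation ky := (ky tau).
Local Notation bb := (bb_vec tau).
(** The subline joins [p = (al, be, 1)] to [r = (a1, b1, ka)]. *)
Variables (al be a1 b1 ka : L).
Hypothesis kaK : frob ka != ka.
Hypothesis D0 : (a1 - ka * al, b1 - ka * be) != (0, 0).

Definition subline_pt (s t : K) : subspace K 6 :=
  <[bb ((s%:A * al + t%:A * a1) / (s%:A + t%:A * ka))
       ((s%:A * be + t%:A * b1) / (s%:A + t%:A * ka)) 1%R]>%VS.

Lemma subline_den_neq0 (s t : K) : (s, t) != (0, 0) -> s%:A + t%:A * ka != 0.
Proof.
apply: contra => /eqP st.
have [t0|t0] := eqVneq t 0.
  by move/eqP: st; rewrite t0 scale0r mul0r addr0 alg_eq0 => /eqP ->.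
case/eqP: kaK; have tA : t%:A != 0 :> L by rewrite alg_eq0.
have -> : ka = (- (t^-1 * s))%:A.
  apply: (mulfI tA); rewrite -algM mulrN mulrA divff // mul1r scaleNr.
  by apply/eqP; rewrite -addr_eq0 addrC st.
by rewrite frob_alg.
Qed.

Lemma vline_bb1_inj a b a' b' :
  <[bb a b 1%R]>%VS = <[bb a' b' 1%R]>%VS -> a = a' /\ b = b'.
Proof.
move=> e; have /vlineP[k kE] : bb a b 1 \in <[bb a' b' 1%R]>%VS by rewrite -e
  memv_line.
have k1 : k = 1 by have := congr1 (@hz K) kE;
  rewrite linearZ /= !hz_bb mulr1 => ->.
move: kE; rewrite k1 scale1r => kE.
have := congr1 kx kE; have := congr1 ky kE.
by rewrite !(kx_bb dimL tau_prim) !(ky_bb dimL tau_prim).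
Qed.

(** This expresses that [(al, be, 1)] and [(a1, b1, ka)] are independent: from
    [S p + T r = 0] the last coordinate gives [S = - ka T]. *)
Lemma D_eq0 T : T * (a1 - ka * al) = 0 -> T * (b1 - ka * be) = 0 -> T = 0.
Proof.
move=> /eqP + /eqP; rewrite !mulf_eq0; case: eqP => //= _ /eqP e1 /eqP e2.
by case/eqP: D0; rewrite e1 e2.
Qed.

(** The cubic [N] is the image of the subline spanned by [w0 = (u, u', x)] and
    [w1 = (v, v', y)].  The points of parameters [(1, 0)], [(0, 1)] and
    [(1, 1)] fix the parametrization: they are [L]-multiples of [K]-combinations
    of [p] and [r], and comparing [w0 + w1] with the third one shows that a
    single [L]-multiple [mu2] is enough for both [w0] and [w1].  The direction
    in [factored_tangent] is quadratic in the numerator and in the denominator,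
    so [mu2] cancels and a factor [h] in [K] remains. *)
Lemma special_tangentE N (s t : K) : is_special_cubic tau N ->
  (forall X, cubic_points N X <->
     exists s' t', (s', t') != (0, 0) /\ X = subline_pt s' t') ->
  (s, t) != (0, 0) -> cubic_point N s t = <[bb al be 1%R]>%VS ->
  cubic_tangent N s t = <<[:: bb al be 1%R;
    bb (a1 - ka * al) (b1 - ka * be) 0%R]>>%VS.
Proof.
move=> N_special pts st0 ptE.
have onN s' t' : (s', t') != (0, 0) -> exists s1 t1, (s1, t1) != (0, 0) /\
    cubic_point N s' t' = subline_pt s1 t1.
  by move=> st'; apply/pts; exists s', t'.
have Zn0 s' t' : (s', t') != (0, 0) -> hz (cubic_vec s' t' *m N) != 0.
  move=> /onN[s1 [t1 [_ e]]]; apply/eqP => z0.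
  have /vlineP[k /(congr1 (@hz K))] :
      bb ((s1%:A * al + t1%:A * a1) / (s1%:A + t1%:A * ka))
         ((s1%:A * be + t1%:A * b1) / (s1%:A + t1%:A * ka)) 1 \in cubic_point
           N s' t'.
    by rewrite e memv_line.
  by rewrite linearZ /= z0 hz_bb mulr0 => /eqP; rewrite oner_eq0.
have [u [v [u' [v' [x [y [m1 [m2 [fac x0]]]]]]]]] :=
  special_factored dimL tau_prim N_special Zn0.
have lift_pt s' t' : (s', t') != (0, 0) ->
  exists (s1 t1 : K) (mu : L), [/\ mu != 0,
    s'%:A * u + t'%:A * v = mu * (s1%:A * al + t1%:A * a1),
    s'%:A * u' + t'%:A * v' = mu * (s1%:A * be + t1%:A * b1)
    & s'%:A * x + t'%:A * y = mu * (s1%:A + t1%:A * ka)].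
  move=> st'; have [s1 [t1 [/subline_den_neq0 d0 e]]] := onN s' t' st'.
  have [c0 + _] := factored_tangent dimL tau_prim fac st' (Zn0 s' t' st').
  rewrite e => /vline_bb1_inj[ea eb].
  exists s1, t1, ((s'%:A * x + t'%:A * y) / (s1%:A + t1%:A * ka)).
  split; first by rewrite mulf_neq0 ?invr_eq0.
  - by rewrite -mulrA [_^-1 * _]mulrC ea [RHS]mulrC divfK.
  - by rewrite -mulrA [_^-1 * _]mulrC eb [RHS]mulrC divfK.
  - by rewrite divfK.
have n10 : ((1 : K), (0 : K)) != (0, 0) by rewrite xpair_eqE oner_eq0.
have n01 : ((0 : K), (1 : K)) != (0, 0) by rewrite xpair_eqE oner_eq0 andbF.
have n11 : ((1 : K), (1 : K)) != (0, 0) by rewrite xpair_eqE oner_eq0.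
have [s0 [t0 [mu0 []]]] := lift_pt _ _ n10.
rewrite !scale1r !scale0r !mul1r !mul0r !addr0 => mu00 uE u'E xE.
have [s1 [t1 [mu1 []]]] := lift_pt _ _ n01.
rewrite !scale1r !scale0r !mul1r !mul0r !add0r => mu10 vE v'E yE.
have [s2 [t2 [mu2 []]]] := lift_pt _ _ n11.
rewrite !scale1r !mul1r => mu20 uvE u'v'E xyE.
pose Delta := s0 * t1 - s1 * t0.
have DE : Delta%:A = s0%:A * t1%:A - s1%:A * t0%:A :> L.
  by rewrite /Delta scalerBl !algM.
have crossx : u * y - x * v = - (mu0 * mu1 * Delta%:A) * (a1 - ka * al).
  by rewrite uE vE xE yE DE; ring.
have crossy : u' * y - x * v' = - (mu0 * mu1 * Delta%:A) * (b1 - ka * be).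
  by rewrite u'E v'E xE yE DE; ring.
(* If the points of parameters (1, 0) and (0, 1) coincided, the first and the
   last row of [N] would be proportional. *)
have Delta0 : Delta != 0.
  apply/eqP => Delta0; rewrite Delta0 scale0r !mulr0 oppr0 !mul0r in crossx
    crossy.
  have [N_free _ _ _] := N_special; have
    [[fx0 _ _ fx3] [fy0 _ _ fy3] [fz0 _ _ fz3]] := fac.
  have [|z30] := row_free_nrow03 (a := hz (nrow N 3%N))
    (b := - hz (nrow N 0%N)) N_free.
    rewrite scaleNr; apply: (kvec_inj dimL tau_prim);
      rewrite ?linearB ?linear0 /= ?kxZ ?kyZ ?linearZ /=;
        last by rewrite mulrC subrr.
      by rewrite fx0 fx3 fz0 fz3; transitivity (m2 * (u * y - x * v));
        [ring|rewrite crossx mulr0].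
    by rewrite fy0 fy3 fz0 fz3; transitivity (m2 * (u' * y - x * v'));
      [ring|rewrite crossy mulr0].
  by move=> /eqP; rewrite oppr_eq0 -(alg_eq0 L) fz0 (negPf x0).
have T0 : mu0 * t0%:A + mu1 * t1%:A - mu2 * t2%:A = 0.
  apply: D_eq0.
    transitivity ((u + v - mu2 * (s2%:A * al + t2%:A * a1))
                  - al * (x + y - mu2 * (s2%:A + t2%:A * ka))).
      by rewrite uE vE xE yE; ring.
    by rewrite uvE xyE !subrr mulr0 subr0.
  transitivity ((u' + v' - mu2 * (s2%:A * be + t2%:A * b1))
                  - be * (x + y - mu2 * (s2%:A + t2%:A * ka))).
    by rewrite u'E v'E xE yE; ring.
  by rewrite u'v'E xyE !subrr mulr0 subr0.
have S0 : mu0 * s0%:A + mu1 * s1%:A - mu2 * s2%:A = 0.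
  transitivity ((x + y - mu2 * (s2%:A + t2%:A * ka))
     - ka * (mu0 * t0%:A + mu1 * t1%:A - mu2 * t2%:A)).
    by rewrite xE yE; ring.
  by rewrite T0 xyE subrr mulr0 subr0.
have DL0 : Delta%:A != 0 :> L by rewrite alg_eq0.
(* Cramer's rule for [w0 + w1] in terms of [p] and [r]. *)
pose k0 := (s2 * t1 - t2 * s1) / Delta; pose k1 := (s0 * t2 - t0 * s2) / Delta.
have mu0E : mu0 = mu2 * k0%:A.
  apply: (mulIf DL0); rewrite -mulrA -algM divfK // DE scalerBl !algM.
  apply/eqP; rewrite -subr_eq0; apply/eqP.
  transitivity (t1%:A * (mu0 * s0%:A + mu1 * s1%:A - mu2 * s2%:A)
     - s1%:A * (mu0 * t0%:A + mu1 * t1%:A - mu2 * t2%:A)); first by ring.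
  by rewrite S0 T0 !mulr0 subr0.
have mu1E : mu1 = mu2 * k1%:A.
  apply: (mulIf DL0); rewrite -mulrA -algM divfK // DE scalerBl !algM.
  apply/eqP; rewrite -subr_eq0; apply/eqP.
  transitivity (s0%:A * (mu0 * t0%:A + mu1 * t1%:A - mu2 * t2%:A)
     - t0%:A * (mu0 * s0%:A + mu1 * s1%:A - mu2 * s2%:A)); first by ring.
  by rewrite S0 T0 !mulr0 subr0.
have k00 : k0 != 0.
  by apply: contra mu00 => /eqP k00; rewrite mu0E k00 scale0r mulr0.
have k10 : k1 != 0.
  by apply: contra mu10 => /eqP k10; rewrite mu1E k10 scale0r mulr0.
have [c0 PE ->] := factored_tangent dimL tau_prim fac st0 (Zn0 s t st0).
move: PE; rewrite ptE => /esym/vline_bb1_inj[aE bE]; rewrite aE bE.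
set c := s%:A * x + t%:A * y in c0 aE bE *.
have {}aE : s%:A * u + t%:A * v = al * c by rewrite -aE divfK.
have {}bE : s%:A * u' + t%:A * v' = be * c by rewrite -bE divfK.
(* The point of parameter (s, t) is [p], so its component along [r] is 0. *)
have G0 : mu0 * (s%:A * t0%:A) + mu1 * (t%:A * t1%:A) = 0.
  apply: D_eq0.
    transitivity (s%:A * u + t%:A * v - al * c); last by rewrite aE subrr.
    by rewrite /c uE vE xE yE; ring.
  transitivity (s%:A * u' + t%:A * v' - be * c); last by rewrite bE subrr.
  by rewrite /c u'E v'E xE yE; ring.
pose f := k0 * (s * s0) + k1 * (t * s1).
have cE : c = mu2 * f%:A.
  transitivity (mu0 * (s%:A * s0%:A) + mu1 * (t%:A * s1%:A)
    + ka * (mu0 * (s%:A * t0%:A) + mu1 * (t%:A * t1%:A))).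
    by rewrite /c xE yE; ring.
  by rewrite G0 mulr0 addr0 mu0E mu1E /f algD !algM; ring.
have f0 : f != 0.
  by apply: contra c0 => /eqP f0; rewrite cE f0 scale0r mulr0.
have fL0 : f%:A != 0 :> L by rewrite alg_eq0.
pose h := - (k0 * k1 * Delta / f ^+ 2).
have h0 : h != 0.
  by rewrite /h oppr_eq0 mulf_neq0 ?invr_eq0 ?expf_neq0 //
    (mulf_neq0 (mulf_neq0 k00 k10)).
have hE : h%:A = - (k0%:A * k1%:A * Delta%:A / f%:A ^+ 2) :> L.
  rewrite scaleNr; congr (- _); apply: (mulIf (expf_neq0 2 fL0)).
  by rewrite divfK ?expf_neq0 // -algX -algM divfK ?expf_neq0 // !algM.
have -> : bb ((u * y - x * v) / c ^+ 2) ((u' * y - x * v') / c ^+ 2) 0 =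
    h *: bb (a1 - ka * al) (b1 - ka * be) 0.
  rewrite (bb_vecZ dimL tau_prim) mulr0; congr bb; rewrite -mulr_algl hE cE.
    by rewrite crossx mu0E mu1E; field; rewrite fL0 mu20.
  by rewrite crossy mu0E mu1E; field; rewrite fL0 mu20.
apply/eqP; rewrite eqEsubv; apply/andP; split; apply/span_subvP => w;
  rewrite !inE => /orP[] /eqP ->; try by apply: memv_span; rewrite !inE eqxx.
  by rewrite memvZ // memv_span // !inE eqxx orbT.
by rewrite -[X in X \in _](scalerK h0) memvZ // memv_span // !inE eqxx orbT.
Qed.

(** The three conjugates of the relation say that one quadratic polynomial,
    whose leading coefficient is [k2], vanishes at the three conjugates of
    [ka]. *)
Lemma cofactor_free (k0 k1 k2 : K) :
  k0%:A + k1%:A * (frob ka + frob (frob ka))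
        + k2%:A * (frob ka * frob (frob ka)) = 0 ->
  [/\ k0 = 0, k1 = 0 & k2 = 0].
Proof.
have [n01 n02 n12] := frob_conj_neq dimL kaK => e0.
have e1 := congr1 frob e0; have e2 := congr1 frob e1.
rewrite !(rmorphD, rmorphM) !rmorph0 /= !frob_alg ?(frob3 dimL) in e1 e2.
pose T := ka + frob ka + frob (frob ka).
pose E := ka * frob ka + ka * frob (frob ka) + frob ka * frob (frob ka).
have [] := @quadratic_three_roots _ (k0%:A + k1%:A * T + k2%:A * E)
  (- k1%:A - k2%:A * T) k2%:A _ _ _ n01 n02 n12.
- by rewrite -[RHS]e0 /T /E; ring.
- by rewrite -[RHS]e1 /T /E; ring.
- by rewrite -[RHS]e2 /T /E; ring.
move=> + + /eqP; rewrite alg_eq0 => + + /eqP k20.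
rewrite k20 !scale0r !mul0r subr0 addr0 => + /eqP.
rewrite oppr_eq0 alg_eq0 => + /eqP k10.
by rewrite k10 scale0r mul0r addr0 => /eqP; rewrite alg_eq0 => /eqP ->.
Qed.

Lemma nrow_cubic_space (N : 'M[K]_(4, 7)) k : nrow N k \in cubic_space N.
Proof.
rewrite memvE /nrow; exact: (sumv_sup (inord k)).
Qed.

(** The cubic of the forms [(s al + t a1) M], [(s be + t b1) M], [(s + t ka) M],
    where [M = s^2 + f s t + g t^2] is the product of the two conjugates of
    [s + t ka] other than itself; the third form is a norm, hence has its
    coefficients in [K].  It meets the transversal of index [j] where the
    conjugate of index [j] of [s + t ka] vanishes, because that linear form
    divides every conjugate of [M] except the one of index [j]. *)
Lemma special_cubic_exists : exists N : 'M[K]_(4, 7),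
  [/\ is_special_cubic tau N,
      forall s t, (s, t) != (0, 0) -> cubic_point N s t = subline_pt s t
    & cubic_point N 1 0 = <[bb al be 1%R]>%VS].
Proof.
pose f := frob ka + frob (frob ka); pose g := frob ka * frob (frob ka).
have fixK x : frob x = x -> exists k : K, k%:A = x by case/frob_fixed=> k ->;
  exists k.
(* The elementary symmetric functions of the conjugates of [ka]. *)
have [z1 z1E] : exists k : K, k%:A = ka + f.
  by apply: fixK; rewrite /f !rmorphD /= (frob3 dimL); ring.
have [z2 z2E] : exists k : K, k%:A = g + ka * f.
  by apply: fixK; rewrite /f /g !(rmorphD, rmorphM) /= (frob3 dimL); ring.
have [z3 z3E] : exists k : K, k%:A = ka * g.
  by apply: fixK; rewrite /g !rmorphM /= (frob3 dimL); ring.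
pose rows := [:: bb al be 1; bb (a1 + f * al) (b1 + f * be) z1;
  bb (g * al + f * a1) (g * be + f * b1) z2; bb (g * a1) (g * b1) z3].
pose N : 'M[K]_(4, 7) := \matrix_(i < 4) rows`_i.
have NE k : (k < 4)%N -> nrow N k = rows`_k by move=> k4;
  rewrite /nrow rowK inordK.
have N0 : nrow N 0 = _ := NE 0%N isT; have N1 : nrow N 1 = _ := NE 1%N isT.
have N2 : nrow N 2 = _ := NE 2%N isT; have N3 : nrow N 3 = _ := NE 3%N isT.
rewrite /= in N0 N1 N2 N3.
pose rE := (N0, N1, N2, N3).
have kxb := kx_bb dimL tau_prim; have kyb := ky_bb dimL tau_prim.
have fac : factored tau N al a1 be b1 1 ka f g.
  split; split; rewrite !rE ?kxb ?kyb ?hz_bb //.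
  - by rewrite scale1r.
  - by rewrite z1E; ring.
  - by rewrite z2E; ring.
  - by rewrite z3E; ring.
have hzE s t : (hz (cubic_vec s t *m N))%:A =
   (s%:A + t%:A * ka) * (s%:A + t%:A * frob ka) *
     (s%:A + t%:A * frob (frob ka)) :> L.
  rewrite cubic_vecE !linearD /= !linearZ /= !rE !hz_bb !algE z1E z2E z3E
    scale1r /f /g.
  by ring.
have hz0 s t : (s, t) != (0, 0) -> hz (cubic_vec s t *m N) != 0.
  move=> /subline_den_neq0 c0; rewrite -(alg_eq0 L) hzE.
  have frobE x : frob (s%:A + t%:A * x) = s%:A + t%:A * frob x.
    by rewrite rmorphD rmorphM /= !frob_alg.
  by rewrite -!frobE !mulf_neq0 // !fmorph_eq0.
have ptE s t : (s, t) != (0, 0) -> cubic_point N s t = subline_pt s t.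
  move=> st0; have [_ -> _] := factored_tangent dimL tau_prim fac st0
    (hz0 s t st0).
  by rewrite mulr1.
exists N; split=> //; last first.
  rewrite ptE ?xpair_eqE ?oner_eq0 // /subline_pt scale1r scale0r.
  by rewrite !mul1r !mul0r !addr0 !divr1.
have comb_eq0 (k0 k1 k2 k3 : K) : 
    k0 *: nrow N 0 + k1 *: nrow N 1 + k2 *: nrow N 2 + k3 *: nrow N 3 = 0 ->
    [/\ k0 = 0, k1 = 0, k2 = 0 & k3 = 0].
  move=> e.
  pose U := k0%:A + k1%:A * f + k2%:A * g;
    pose V := k1%:A + k2%:A * f + k3%:A * g.
  have eU : U + V * ka = 0.
    have := congr1 (fun v => (hz v)%:A : L) e.
    rewrite !linearD /= !linearZ /= linear0 !rE !hz_bb !algE z1E z2E z3E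
      scale1r scale0r.
    by move=> <-; rewrite /U /V; ring.
  have eX : U * al + V * a1 = 0.
    have := congr1 kx e.
    rewrite !linearD /= !kxZ linear0 !rE !kxb.
    by move=> <-; rewrite /U /V; ring.
  have eY : U * be + V * b1 = 0.
    have := congr1 ky e.
    rewrite !linearD /= !kyZ linear0 !rE !kyb.
    by move=> <-; rewrite /U /V; ring.
  have V0 : V = 0.
    apply: D_eq0.
      by transitivity (U * al + V * a1 - al * (U + V * ka));
        [ring | rewrite eX eU mulr0 subr0].
    by transitivity (U * be + V * b1 - be * (U + V * ka));
      [ring | rewrite eY eU mulr0 subr0].
  have [-> -> ->] := cofactor_free V0.
  by move: eU; rewrite V0 mul0r addr0 => /cofactor_free[-> _ _].
split.
- apply: inj_row_free => v.
  rewrite mulmx_nrow => /comb_eq0[v0 v1 v2 v3]; apply/rowP => i; rewrite mxE.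
  rewrite -[i]inord_val; case: i => -[|[|[|[|//]]]] i4 /=;
    [exact: v0 | exact: v1 | exact: v2 | exact: v3].
- apply/negP => /subvP/(_ _ (nrow_cubic_space N 0))/hyperplane_infP.
  rewrite (_ : ord_max = rshift 6 ord0) ; last exact: val_inj.
  by rewrite -/(hz _) rE hz_bb => /eqP; rewrite oner_eq0.
- exists (a1 - ka * al), (b1 - ka * be); split=> //.
  apply/subvP => _ /spread_planeP[x ->].
  have [k1 [k2 [k3 xE]]] : exists k1 k2 k3 :
    K, x = k1%:A + k2%:A * f + k3%:A * g.
    have B : basis_of {:L} [tuple 1; f; g].
      rewrite basisEfree subvf dimL /= andbT.
      apply/freeP => k; rewrite !big_ord_recl big_ord0 /= addr0
        -!(mulr_algl (k _) f) -!(mulr_algl (k _) g) addrA.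
      move/cofactor_free => [k00 k10 k20].
      by case=> -[|[|[|//]]] h; [rewrite -k00|rewrite -k10|rewrite -k20];
        congr k; exact: val_inj.
    rewrite (coord_basis B (memvf x)) !big_ord_recl big_ord0 /= addr0 addrA.
    by do 3 eexists; rewrite !mulr_algl.
  (* This choice makes the [z] coordinate vanish. *)
  pose k0 := - (k1 * z1 + k2 * z2 + k3 * z3).
  have k0E : k0%:A = - (k1%:A * (ka + f) + k2%:A * (g + ka * f) + k3%:A *
    (ka * g)) :> L.
    by rewrite /k0 scaleNr !algE z1E z2E z3E.
  have -> : bb ((a1 - ka * al) * x) ((b1 - ka * be) * x) 0 =
     k0 *: nrow N 0 + k1 *: nrow N 1 + k2 *: nrow N 2 + k3 *: nrow N 3.
    apply: (kvec_inj dimL tau_prim);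
      rewrite ?kxb ?kyb ?hz_bb !linearD /= ?kxZ ?kyZ ?linearZ /= !rE ?kxb ?kyb
        ?hz_bb.
    + by rewrite k0E xE; ring.
    + by rewrite k0E xE; ring.
    + by rewrite /k0; ring.
  by rewrite !memvD // memvZ // nrow_cubic_space.
move=> G /(transversal_classification dimL tau_prim)[j j3 memG].
pose w := cubic_vec (- iter j frob ka) 1 *m ext N.
exists (cubic_point (ext N) (- iter j frob ka) 1).
  by exists (- iter j frob ka), 1; rewrite xpair_eqE oner_eq0 andbF.
rewrite -memvE; apply: memG.
  rewrite cubic_vecE !linearD /= !linearZ /= !nrow_ext !rE !hz_ext !hz_bb z1E
    z2E z3E scale1r.
  by case: j j3 {w} => [|[|[|//]]] _ /=; rewrite /f /g; ring.
have hx2 k v : hx (iter k frob tau) (ext v) = iter k frob (kx v) :=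
  hx_ext k tau v.
have hy2 k v : hy (iter k frob tau) (ext v) = iter k frob (ky v) :=
  hy_ext k tau v.
move=> k k3 kj; rewrite !cubic_vecE !linearD /= !linearZ /= !nrow_ext !hx2
  !hy2 !rE !kxb !kyb.
by case: j j3 kj {w} => [|[|[|//]]] _; case: k k3 => [|[|[|//]]] _ //= _;
   rewrite /f /g ?(rmorphD, rmorphM) /= ?(frob3 dimL); split; ring.
Qed.

End Subline.

(** * Lines of an exterior subplane *)

Section BruckBosePoints.
Variables (K : finFieldType) (L : fieldExtType K) (tau : L).
Local Notation bb := (bb_vec tau).

Definition row_x (w : 'rV[L]_3) : L := w 0 (inord 0).
Definition row_y (w : 'rV[L]_3) : L := w 0 (inord 1).
Definition row_z (w : 'rV[L]_3) : L := w 0 ord_max.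

Lemma row3_inj u v : row_x u = row_x v -> row_y u = row_y v ->
  row_z u = row_z v -> u = v.
Proof.
rewrite /row_x /row_y /row_z => ex ey ez; apply/rowP => i;
  rewrite -[i]inord_val.
case: i => -[|[|[|//]]] h //=.
by rewrite (_ : inord 2 = ord_max) //; apply: val_inj; rewrite /= inordK.
Qed.

Lemma row_x_vec3 a b c : row_x (vec3 a b c) = a.
Proof. by rewrite /row_x mxE inordK. Qed.
Lemma row_y_vec3 a b c : row_y (vec3 a b c) = b.
Proof. by rewrite /row_y mxE inordK. Qed.
Lemma row_z_vec3 a b c : row_z (vec3 a b c) = c.
Proof. by rewrite /row_z mxE. Qed.
Lemma row_xZ k w : row_x (k *: w) = k * row_x w. Proof. exact: mxE. Qed.
Lemma row_yZ k w : row_y (k *: w) = k * row_y w. Proof. exact: mxE. Qed.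
Lemma row_zZ k w : row_z (k *: w) = k * row_z w. Proof. exact: mxE. Qed.

Lemma vlineZ (F : fieldType) (V : vectType F) (k : F) (w : V) : k != 0 ->
  <[k *: w]>%VS = <[w]>%VS.
Proof.
move=> k0; apply/eqP; rewrite eqEsubv -!memvE memvZ ?memv_line //=.
by rewrite -{1}[w](scalerK k0) memvZ ?memv_line.
Qed.

Lemma bruck_bose_affine w Q : row_z w != 0 ->
  bruck_bose tau <[w]>%VS Q <-> Q = <[bb (row_x w / row_z w)
    (row_y w / row_z w) 1%R]>%VS.
Proof.
move=> z0; split=> [[[a [b [wE ->]]]|[a [b [_ wE _ _]]]]|->].
- have /vlineP[k vE] : vec3 a b 1 \in <[w]>%VS by rewrite wE memv_line.
  have := congr1 row_z vE; rewrite row_zZ row_z_vec3 => kz.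
  have kE : k = (row_z w)^-1 by apply: (mulIf z0); rewrite -kz mulVf //.
  have aE : a = row_x w / row_z w by rewrite -[LHS](row_x_vec3 a b 1) vE
    row_xZ kE mulrC.
  have bE : b = row_y w / row_z w by rewrite -[LHS](row_y_vec3 a b 1) vE
    row_yZ kE mulrC.
  by rewrite aE bE.
- case/eqP: z0; have /vlineP[k ->] :
  w \in <[vec3 a b 0]>%VS by rewrite -wE memv_line.
  by rewrite row_zZ row_z_vec3 mulr0.
left; exists (row_x w / row_z w), (row_y w / row_z w); split=> //.
rewrite -[RHS](vlineZ _ z0); congr <[_]>%VS; apply: row3_inj.
- by rewrite row_xZ row_x_vec3 mulrC divfK.
- by rewrite row_yZ row_y_vec3 mulrC divfK.
- by rewrite row_zZ row_z_vec3 mulr1.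
Qed.
End BruckBosePoints.

Section ExteriorSubplane.
Variables (K : finFieldType) (L : fieldExtType K).
Variable tau : L.
Hypothesis dimL : \dim {:L} = 3%N.
Hypothesis tau_prim : ((#|K| ^ 3).-1)%N.-primitive_root tau.
Local Notation frob := (@frob K L).
Local Notation ext := (map_mx (in_alg L)).
Local Notation bb := (bb_vec tau).
Variable A : 'M[L]_3.
Hypothesis A_unit : A \in unitmx.
Hypothesis z_neq0 : forall v : 'rV[K]_3, v != 0 -> row_z (ext v *m A) != 0.
Variable p : 'rV[K]_3.
Hypothesis p0 : p != 0.
Variable pi : point_set L 2.
Hypothesis piE : forall U, pi U <-> exists2 v :
  'rV[K]_3, v != 0 & U = <[ext v *m A]>%VS.

(** Homogeneous coordinates of the point of the subplane given by [v], scaled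
    so that those of [p] become affine. *)
Definition px v : L := row_x (ext v *m A) / row_z (ext p *m A).
Definition py v : L := row_y (ext v *m A) / row_z (ext p *m A).
Definition pz v : L := row_z (ext v *m A) / row_z (ext p *m A).

Lemma px_comb s t u v : px (s *: u + t *: v) = s%:A * px u + t%:A * px v.
Proof.
by rewrite /px map_mxD !map_mxZ mulmxDl -!scalemxAl /row_x !mxE mulrDl !mulrA.
Qed.
Lemma py_comb s t u v : py (s *: u + t *: v) = s%:A * py u + t%:A * py v.
Proof.
by rewrite /py map_mxD !map_mxZ mulmxDl -!scalemxAl /row_y !mxE mulrDl !mulrA.
Qed.
Lemma pz_comb s t u v : pz (s *: u + t *: v) = s%:A * pz u + t%:A * pz v.
Proof.
by rewrite /pz map_mxD !map_mxZ mulmxDl -!scalemxAl /row_z !mxE mulrDl !mulrA.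
Qed.

Lemma pz_p : pz p = 1. Proof. by rewrite /pz divff ?z_neq0. Qed.

Lemma pz_neq0 v : v != 0 -> pz v != 0.
Proof. by move=> v0; rewrite mulf_neq0 ?invr_eq0 ?z_neq0. Qed.

Lemma ext_frob n (v : 'rV[K]_n) : map_mx frob (ext v) = ext v.
Proof. by apply/rowP => i; rewrite !mxE /= frob_alg. Qed.

(** A factor relating two rational vectors is rational, as any nonzero entry of
    [p] shows. *)
Lemma ext_proportional (v : 'rV[K]_3) (c : L) : ext v = c *: ext p ->
  exists k, v = k *: p.
Proof.
move=> vE; have /rV0Pn[i pi0] := p0.
have cE : c = (v 0 i / p 0 i)%:A.
  have piA : (p 0 i)%:A != 0 :> L by rewrite alg_eq0.
  apply: (mulIf piA); rewrite -algM divfK //.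
  by have /rowP/(_ i) := vE; rewrite !mxE /= => ->.
exists (v 0 i / p 0 i); apply: (map_mx_inj (f := in_alg L)).
by rewrite map_mxZ vE cE.
Qed.

Lemma ext_indep r (x y : L) : (forall k, r != k *: p) ->
  x *: ext p + y *: ext r = 0 -> x = 0 /\ y = 0.
Proof.
move=> rp e.
have [y0|y0] := eqVneq y 0; last first.
  have [|k rE] := @ext_proportional r (- (x / y)); last by have := rp k;
    rewrite rE eqxx.
  apply: (scalerI y0); apply/eqP; rewrite scaleNr scalerN scalerA mulrC divfK
    //.
  by rewrite -addr_eq0 addrC e.
split=> //; move/eqP: e; rewrite y0 scale0r addr0 scaler_eq0 map_mx_eq0
  (negPf p0) orbF.
by move/eqP.
Qed.

Lemma comb_neq0 r (s t : K) : (forall k, r != k *: p) ->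
  (s, t) != (0, 0) -> s *: p + t *: r != 0.
Proof.
move=> rp; apply: contra => /eqP /(congr1 ext).
rewrite map_mxD !map_mxZ raddf0 => /(ext_indep rp)[] /eqP + /eqP.
by rewrite /= !alg_eq0 => /eqP -> /eqP ->.
Qed.

Lemma pcoords_prop v c : px v = c * px p -> py v = c * py p -> pz v = c ->
  exists k, v = k *: p.
Proof.
have z0 : (row_z (ext p *m A))^-1 != 0 by rewrite invr_eq0 z_neq0.
move=> ex ey ez; apply: (@ext_proportional _ c).
apply: (can_inj (mulmxK A_unit)); rewrite -scalemxAl; apply: row3_inj.
- by apply: (mulIf z0); rewrite row_xZ -mulrA.
- by apply: (mulIf z0); rewrite row_yZ -mulrA.
- by apply: (mulIf z0); rewrite row_zZ -mulrA -/(pz _) ez -/(pz p) pz_p mulr1.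
Qed.

Lemma pz_notin_K r : (forall k, r != k *: p) -> frob (pz r) != pz r.
Proof.
move=> rp; apply/eqP => /frob_fixed[k kE].
have : r - k *: p != 0 by rewrite subr_eq0.
by move/pz_neq0; rewrite -(scale1r r) -scaleNr pz_comb pz_p kE scaleNr scale1r
  mul1r mulr1 subrr eqxx.
Qed.

Lemma direction_neq0 r : (forall k, r != k *: p) ->
  (px r - pz r * px p, py r - pz r * py p) != (0, 0).
Proof.
move=> rp; apply/eqP => -[/eqP + /eqP]; rewrite !subr_eq0 => /eqP ex /eqP ey.
by have [k rE] := pcoords_prop ex ey erefl; have := rp k; rewrite rE eqxx.
Qed.

Lemma bruck_bose_subplane v Q : v != 0 ->
  bruck_bose tau <[ext v *m A]>%VS Q <->
  Q = <[bb (px v / pz v) (py v / pz v) 1%R]>%VS.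
Proof.
move=> v0; have z0 := z_neq0 v0; have zp0 := z_neq0 p0.
rewrite (bruck_bose_affine tau Q z0) /px /py /pz.
have E x : x / row_z (ext p *m A) / (row_z (ext v *m A) / row_z (ext p *m A)) =
   x / row_z (ext v *m A) by field; rewrite z0 zp0.
by rewrite !E.
Qed.

(** The direction of the tangent at [p] to the cubic of the line joining [p]
    to [v]. *)
Definition direction v : 'rV[K]_7 :=
  bb (px v - pz v * px p) (py v - pz v * py p) 0.

Definition affine_pt : 'rV[K]_7 := bb (px p) (py p) 1.

(** If a rational vector is an [L]-combination of the independent rational
    vectors [p] and [r], then conjugating its coefficients yields a second
    such expression, so that they lie in [K]. *)
Lemma subplane_line_pts l : is_subplane_line pi l -> (<[ext p *m A]> <= l)%VS ->
  exists2 r, (forall k, r != k *: p) &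
    forall U, subline pi l U <->
      exists s t : K, (s, t) != (0, 0) /\ U = <[ext (s *: p + t *: r) *m A]>%VS.
Proof.
move=> [dim_l [U [V [piU piV UV Ul Vl]]]] pl.
have [W [piW WP Wl]] : exists W, [/\ pi W,
  W != <[ext p *m A]>%VS & (W <= l)%VS].
  have [UP|UP] := eqVneq U <[ext p *m A]>%VS; last by exists U.
  by exists V; rewrite -UP eq_sym.
have [r r0 WE] := (piE W).1 piW.
have rp k : r != k *: p.
  apply: contra WP => /eqP rE; rewrite WE rE map_mxZ -scalemxAl vlineZ //.
  by apply: contra r0; rewrite /= alg_eq0 => /eqP k0; rewrite rE k0 scale0r.
exists r => // {piU piV UV Ul Vl} X.
have inj0 (w : 'rV[L]_3) : w *m A = 0 -> w = 0.
  by move=> w0; apply: (can_inj (mulmxK A_unit)); rewrite w0 mul0mx.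
have lE : l = <<[:: ext p *m A; ext r *m A]>>%VS.
  apply/esym/eqP; rewrite eqEdim; apply/andP; split.
    by apply/span_subvP => w; rewrite !inE => /orP[]/eqP ->;
      rewrite memvE // -WE.
  rewrite dim_l dim_span2 // => a b; rewrite !scalemxAl -mulmxDl => /inj0.
  exact: ext_indep.
split=> [[/piE[v v0 ->]]|[s [t [st0 ->]]]]; last first.
  split.
    by apply/piE; exists (s *: p + t *: r) => //; exact: comb_neq0.
  rewrite -memvE lE; apply/span2P; exists s%:A, t%:A.
  by rewrite map_mxD !map_mxZ mulmxDl -!scalemxAl.
rewrite -memvE lE => /span2P[a [b]]; rewrite !scalemxAl -mulmxDl.
move/(can_inj (mulmxK A_unit)) => vE.
have /(ext_indep rp)[/eqP + /eqP] : (a - frob a) *: ext p + (b - frob b) *: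
  ext r = 0.
  rewrite !scalerBl addrACA -opprD -vE.
  by rewrite -{1}[ext v]ext_frob vE map_mxD !map_mxZ !ext_frob subrr.
rewrite !subr_eq0 eq_sym => /eqP/frob_fixed[s sE];
  rewrite eq_sym => /eqP/frob_fixed[t tE].
have vK : v = s *: p + t *: r.
  by apply: (map_mx_inj (f := in_alg L)); rewrite vE sE tE map_mxD !map_mxZ.
exists s, t; rewrite -vK; split=> //.
by apply: contra v0 => /eqP[s0 t0]; rewrite vK s0 t0 !scale0r addr0.
Qed.

Lemma special_tangentP l : is_subplane_line pi l -> (<[ext p *m A]> <= l)%VS ->
  exists r, forall m,
    is_special_tangent tau (bruck_bose_set tau (subline pi l))
      <[affine_pt]>%VS m <->
    m = <<[:: affine_pt; direction r]>>%VS.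
Proof.
move=> l_line pl; have [r rp l_pts] := subplane_line_pts l_line pl;
  exists r => m.
have rK := pz_notin_K rp; have D0 := direction_neq0 rp.
pose X := subline_pt tau (px p) (py p) (px r) (py r) (pz r).
have setE Q : bruck_bose_set tau (subline pi l) Q <->
    exists s t, (s, t) != (0, 0) /\ Q = X s t.
  have XE s t : X s t = <[bb (px (s *: p + t *: r) / pz (s *: p + t *: r))
                            (py (s *: p + t *: r) / pz (s *: p + t *: r))
                              1%R]>%VS.
    by rewrite px_comb py_comb pz_comb pz_p mulr1.
  split=> [[U /l_pts[s [t [st0 ->]]]]|[s [t [st0 ->]]]].
    by move=> /(bruck_bose_subplane _ (comb_neq0 rp st0)) ->; exists s, t;
      rewrite XE.
  exists <[ext (s *: p + t *: r) *m A]>%VS; first by apply/l_pts; exists s, t.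
  by apply/(bruck_bose_subplane _ (comb_neq0 rp st0)); rewrite XE.
split=> [[N [N_special NC [s [t [st0 /esym ptE ->]]]]]|->].
  apply: (special_tangentE dimL tau_prim rK D0 N_special) => // Q.
  by rewrite NC setE.
have [N [N_special Npt N10]] := special_cubic_exists dimL tau_prim rK D0.
have NX Q : cubic_points N Q <-> exists s t, (s, t) != (0, 0) /\ Q = X s t.
  by split=> -[s [t [st0 ->]]]; exists s, t; rewrite Npt.
have n10 : ((1 : K), (0 : K)) != (0, 0) by rewrite xpair_eqE oner_eq0.
exists N; split=> // [Q|]; first by rewrite NX setE.
by exists 1, 0; split=> //; rewrite
  (special_tangentE dimL tau_prim rK D0 N_special).
Qed.

Fact direction_linear : linear direction.
Proof.
move=> k u v; rewrite /direction (bb_vecDZ dimL tau_prim) mulr0 addr0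
  -{1 2 3 4}(scale1r v).
by rewrite px_comb py_comb pz_comb !scale1r; congr bb;
  rewrite -[in RHS]mulr_algl; ring.
Qed.

(** The map [direction] is [K]-linear on a space of dimension 3 with kernel
    [<[p]>], so its image is a line at infinity; joining it to the affine point
    [affine_pt] gives a plane. *)
Lemma tangent_plane_exists : exists T : subspace K 6,
  \dim T = 3%N /\ forall r, (<<[:: affine_pt; direction r]>> <= T)%VS.
Proof.
pose g : {linear _ -> _} := HB.pack direction
  (GRing.isLinear.Build _ _ _ _ direction direction_linear).
have gE r : linfun g r = direction r by rewrite lfunE.
have ker_g : lker (linfun g) = <[p]>%VS.
  apply/vspaceP => v; rewrite memv_ker gE; apply/eqP/vlineP => [d0|[k ->]].
    have := congr1 (kx tau) d0; have := congr1 (ky tau) d0.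
    rewrite (kx_bb dimL tau_prim) (ky_bb dimL tau_prim) !linear0.
    by move=> /eqP + /eqP; rewrite !subr_eq0 => /eqP ey /eqP ex;
      apply: pcoords_prop ex ey _.
  rewrite -[X in direction X]addr0 direction_linear.
  have -> : direction p = 0.
    apply: (kvec_inj dimL tau_prim); rewrite ?linear0 ?(kx_bb dimL tau_prim)
      ?(ky_bb dimL tau_prim) ?hz_bb //.
      by rewrite pz_p mul1r subrr.
    by rewrite pz_p mul1r subrr.
  by rewrite scaler0 add0r -gE linear0.
have dim_g : \dim (limg (linfun g)) = 2%N.
  have := limg_ker_dim (linfun g) fullv.
  rewrite (capv_idPr (subvf _)) ker_g dim_vline p0 dimvf.
  by rewrite [dim _](_ : _ = 3%N) // => -[].
have pt0 : affine_pt != 0.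
  apply/eqP => /(congr1 (@hz K)); rewrite hz_bb linear0 => /eqP.
  by rewrite oner_eq0.
exists (<[affine_pt]> + limg (linfun g))%VS; split.
  rewrite dimv_disjoint_sum; first by rewrite dim_vline pt0 dim_g.
  apply/eqP; rewrite -subv0; apply/subvP => w; rewrite memv_cap.
  case/andP=> /vlineP[k ->] /memv_imgP[v _].
  rewrite gE => /(congr1 (@hz K)); rewrite linearZ /= !hz_bb mulr1 => ->.
  by rewrite scale0r mem0v.
move=> r; apply/span_subvP => w; rewrite !inE => /orP[] /eqP ->.
  by apply: (subvP (addvSl _ _)); exact: memv_line.
by apply: (subvP (addvSr _ _)); rewrite -gE memv_img ?memvf.
Qed.

End ExteriorSubplane.

Theorem theorem4p2
  (K : finFieldType) (L : fieldExtType K) (dimL : \dim {:L} = 3%N)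
  (tau : L) (tau_prim : ((#|K| ^ 3).-1)%N.-primitive_root tau)
  (pi : point_set L 2) (pi_subplane : is_subplane pi) (pi_ext : exterior pi)
  (P : subspace L 2) (P_pi : pi P)
  (P' : subspace K 6) (PP' : bruck_bose tau P P')
  (ell : 'I_(#|K|.+1) -> subspace L 2) (ell_inj : injective ell)
  (ell_lines : forall l : subspace L 2,
     (is_subplane_line pi l /\ (P <= l)%VS) <-> exists i, ell i = l) :
  let tangent i := is_special_tangent tau
                     (bruck_bose_set tau (subline pi (ell i))) P' in
  (forall i, exists! m : subspace K 6, tangent i m) /\
  (forall m : 'I_(#|K|.+1) -> subspace K 6,
     (forall i, tangent i (m i)) ->
     exists T : subspace K 6, \dim T = 3%N /\ forall i, (m i <= T)%VS).
Proof.
have [A A_unit piE] := pi_subplane.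
have z_neq0 (v : 'rV[K]_3) : v != 0 -> row_z (map_mx (in_alg L) v *m A) != 0.
  move=> v0; have /pi_ext : pi <[map_mx (in_alg L) v *m A]>%VS by apply/piE;
    exists v.
  by apply: contra => /eqP z0; rewrite -memvE; apply/hyperplane_infP.
have [p p0 PE] := (piE P).1 P_pi.
have {}PP' : P' = <[affine_pt tau A p]>%VS.
  have := (bruck_bose_subplane tau z_neq0 p0 P' p0).1.
  by rewrite -PE (pz_p z_neq0 p0) !divr1 => /(_ PP').
move=> tangent.
have tangentP i : exists r, forall m,
    tangent i m <-> m = <<[:: affine_pt tau A p; direction tau A p r]>>%VS.
  have [l_line] := (ell_lines (ell i)).2 (ex_intro _ i erefl).
  rewrite PE /tangent PP'; exact: special_tangentP.
have [T [dimT T_sub]] := tangent_plane_exists dimL tau_prim A_unit z_neq0 p0.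
split=> [i|m tangent_m].
  have [r rP] := tangentP i; exists <<[:: affine_pt tau A p;
    direction tau A p r]>>%VS.
  by split=> [|m /rP->]; first exact/rP.
exists T; split=> // i; have [r rP] := tangentP i.
by rewrite ((rP _).1 (tangent_m i)).
Qed.
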